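(* Let $n\geqslant 2$, let $c\in\mathbb{R}^n$ satisfy $\alpha(c)>\max_{x\in\mathbb{T}^n}V(x)$, let $u_c$ be a $\mathbb{Z}^n$-periodic viscosity solution of $H(x,c+Du(x))=\alpha(c)$, where $H(x,p)=\frac12\langle A(x)p,p\rangle+V(x)$, and let $v(x)=u_c(x)+\langle c,x\rangle$ for $x\in\mathbb{R}^n$. Let $x\in\Sigma_v$. Then $0\notin D^+v(x)$ if and only if $x$ is not a local maximum point of $v$ and the level set $\Lambda_x=\{y\in\mathbb{R}^n: v(y)=v(x)\}$ is an $(n-1)$-dimensional Lipschitz submanifold near $x$.
   Context: $A(x)$ is a symmetric positive definite $n\times n$ matrix, smooth and $\mathbb{Z}^n$-periodic in $x\in\mathbb{R}^n$; $V$ is a smooth $\mathbb{Z}^n$-periodic real function on $\mathbb{R}^n$; $\mathbb{T}^n=\mathbb{R}^n/\mathbb{Z}^n$ is the flat torus. For $c\in\mathbb{R}^n$, $\alpha(c)$ (Mather's $\alpha$-function) is the unique real number such that $H(x,c+Du(x))=\alpha(c)$ admits a $\mathbb{Z}^n$-periodic viscosity solution. Such solutions (also called weak KAM solutions) are locally semiconcave with linear modulus. For a continuous function $w$, $D^+w(x)=\{p\in\mathbb{R}^n:\limsup_{y\to x}\frac{w(y)-w(x)-\langle p,y-x\rangle}{|y-x|}\leqslant 0\}$ and $D^-w(x)=\{p\in\mathbb{R}^n:\liminf_{y\to x}\frac{w(y)-w(x)-\langle p,y-x\rangle}{|y-x|}\geqslant 0\}$. A continuous function $u$ is a viscosity solution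 of $H(x,c+Du(x))=\alpha(c)$ if for every $x$: $H(x,c+p)\leqslant\alpha(c)$ for all $p\in D^+u(x)$, and $H(x,c+p)\geqslant\alpha(c)$ for all $p\in D^-u(x)$. The singular set $\Sigma_v$ is the set of points $x$ at which $D^+v(x)$ is not a singleton. ''$\Lambda_x$ is an $(n-1)$-dimensional Lipschitz submanifold near $x$'' means that, in some neighborhood of $x$ and after an invertible linear change of coordinates $\mathbb{R}^n\to\mathbb{R}^{n-1}\times\mathbb{R}$, $\Lambda_x$ is the graph of a Lipschitz function $f:\mathbb{R}^{n-1}\to\mathbb{R}$. *)

(* Defs.v *)
From HB Require Import structures.
From mathcomp Require Import all_boot all_order all_algebra.
From mathcomp Require Import all_classical all_reals all_analysis.

Set Implicit Arguments.
Unset Strict Implicit.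
Unset Printing Implicit Defensive.

Import Order.TTheory GRing.Theory Num.Theory.
Import numFieldNormedType.Exports.

Local Open Scope classical_set_scope.
Local Open Scope ring_scope.

(* R^n is 'cV[R]_n. The norm `|x| of MathComp-Analysis on it is the sup norm,  *)
(* which induces the usual topology; the Euclidean norm is enorm.              *)

Definition dot (R : realType) (n : nat) (p q : 'cV[R]_n) : R :=
  \sum_(i < n) p i 0 * q i 0.

Definition enorm (R : realType) (n : nat) (p : 'cV[R]_n) : R :=
  Num.sqrt (dot p p).

Definition Zn_periodic (R : realType) (n : nat) (T : Type)
    (f : 'cV[R]_n -> T) : Prop :=
  forall (x : 'cV[R]_n) (k : 'cV[int]_n), f (x + map_mx intr k) = f x.

Fixpoint Ck (R : realType) (n k : nat) (f : 'cV[R]_n -> R) : Prop :=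
  if k is k'.+1 then
    continuous f /\
    forall i : 'I_n,
      (forall x, derivable f x (delta_mx i 0)) /\
      Ck k' (fun x => 'D_(delta_mx i 0) f x)
  else continuous f.

Definition smooth (R : realType) (n : nat) (f : 'cV[R]_n -> R) : Prop :=
  forall k : nat, Ck k f.

Definition smooth_mx (R : realType) (n : nat)
    (A : 'cV[R]_n -> 'M[R]_n) : Prop :=
  forall i j : 'I_n, smooth (fun x => A x i j).

Definition sym_posdef (R : realType) (n : nat) (M : 'M[R]_n) : Prop :=
  M \is symmetricmx /\ forall p : 'cV[R]_n, p != 0 -> 0 < dot (M *m p) p.

Definition hamiltonian (R : realType) (n : nat) (A : 'cV[R]_n -> 'M[R]_n)
    (V : 'cV[R]_n -> R) (x p : 'cV[R]_n) : R :=
  2^-1 * dot (A x *m p) p + V x.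

Definition diff_quotient (R : realType) (n : nat) (w : 'cV[R]_n -> R)
    (x p y : 'cV[R]_n) : \bar R :=
  ((w y - w x - dot p (y - x)) / enorm (y - x))%:E.

(* x^' is the filter of punctured neighbourhoods of x. *)
Definition superdiff (R : realType) (n : nat) (w : 'cV[R]_n -> R)
    (x : 'cV[R]_n) : set 'cV[R]_n :=
  [set p | (limf_esup (diff_quotient w x p) x^' <= 0)%E].

Definition subdiff (R : realType) (n : nat) (w : 'cV[R]_n -> R)
    (x : 'cV[R]_n) : set 'cV[R]_n :=
  [set p | (0 <= limf_einf (diff_quotient w x p) x^')%E].

(* Viscosity solutions of H(x, c + Du(x)) = a on R^n. *)
Definition viscosity_solution (R : realType) (n : nat)
    (H : 'cV[R]_n -> 'cV[R]_n -> R) (c : 'cV[R]_n) (a : R)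
    (u : 'cV[R]_n -> R) : Prop :=
  continuous u /\
  forall x : 'cV[R]_n,
    (forall p, superdiff u x p -> H x (c + p) <= a) /\
    (forall p, subdiff u x p -> a <= H x (c + p)).

(* For the Hamiltonians considered here exactly one value a is admissible, by  *)
(* the theorem of Lions, Papanicolaou and Varadhan; xget returns it.  The      *)
(* default value 0 would only be used if no value were admissible.             *)
Definition mather_alpha (R : realType) (n : nat)
    (H : 'cV[R]_n -> 'cV[R]_n -> R) (c : 'cV[R]_n) : R :=
  xget 0 [set a : R | exists u : 'cV[R]_n -> R,
                        Zn_periodic u /\ viscosity_solution H c a u].

(* For a continuous Z^n-periodic V the supremum of the range is attained, and  *)
(* it is the maximum over T^n of the function induced by V.                    *)
Definition torus_max (R : realType) (n : nat) (V : 'cV[R]_n -> R) : R :=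
  sup (range V).

Definition singular_set (R : realType) (n : nat) (w : 'cV[R]_n -> R) :
    set 'cV[R]_n :=
  [set x | ~ exists p, superdiff w x = [set p]].

Definition local_maximum (R : realType) (n : nat) (w : 'cV[R]_n -> R)
    (x : 'cV[R]_n) : Prop :=
  \forall y \near x, w y <= w x.

Definition level_set (R : realType) (n : nat) (w : 'cV[R]_n -> R)
    (x : 'cV[R]_n) : set 'cV[R]_n :=
  [set y | w y = w x].

(* S is an (n-1)-dimensional Lipschitz submanifold near x.  Lipschitz          *)
(* continuity of f does not depend on the choice of a norm on R^(n-1).         *)
Definition lipschitz_submanifold_near (R : realType) (n : nat)
    (S : set 'cV[R]_n) (x : 'cV[R]_n) : Prop :=
  exists (L : {linear 'cV[R]_n -> ('cV[R]_(n.-1) * R^o)%type})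
         (f : 'cV[R]_(n.-1) -> R^o),
    [/\ bijective L, lipschitz f &
        \forall y \near x, S y <-> (L y).2 = f (L y).1].

(* Main.v *)
(* Doubling of variables gives a global second-difference estimate for v:     *)
(*   v(x) + v(z) - 2 v(y) <= C sqrt(|x - z|^4 + |x + z - 2y|^2).              *)
(* Indeed, at a maximum of the difference the three variables carry vectors   *)
(* q + r in D^+v(x), q - r in D^+v(z) and q in D^-v(y), and the uniform       *)
(* convexity of H in p bounds |r| in a way incompatible with a large C.       *)
(* Taking z = x shows that v is Lipschitz, and y = (x + z)/2 that v is        *)
(* semiconcave with linear modulus.                                           *)
(*   If 0 is not in D^+v(x), semiconcavity yields a direction theta in which  *)
(* v increases at a uniform rate near x, so its level set is a Lipschitz      *)
(* graph over a hyperplane transversal to theta.  Conversely, if the level    *)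
(* set is such a graph and x is not a local maximum, then v > v(x) on an open *)
(* cone with vertex x; if moreover 0 lies in D^+v(x), then v is flat to first *)
(* order on that cone, so D^-v contains arbitrarily small vectors near x,     *)
(* contradicting H(y, p) >= alpha(c) > max V.                                 *)

Require Import Defs.
From HB Require Import structures.
From mathcomp Require Import all_boot all_order all_algebra.
From mathcomp Require Import all_classical all_reals all_analysis.
From mathcomp Require Import ring lra.

Set Implicit Arguments.
Unset Strict Implicit.
Unset Printing Implicit Defensive.

Import Order.TTheory GRing.Theory Num.Theory.
Import numFieldNormedType.Exports.

Local Open Scope classical_set_scope.
Local Open Scope ring_scope.

(** * Inner product, compactness and semidifferentials *)

(** The analytic core is [second_difference_le_penalty]. If it failed, [penalized_max] would give a
    global maximum of the penalized second difference. There the gradients of the penalty yield H(x,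
    q + r) <= a, H(z, q - r) <= a and a <= H(y, q). But [hamiltonian_second_difference] bounds H(x,
    q + r) + H(z, q - r) - 2 H(y, q) below by lam |r|^2 minus errors that vanish with x - z and x +
    z - 2y, while the form of the penalty forces |r| >= C |x - z|; a large C is impossible. Suppose
    0 is not in D^+v(x). Then x is not a local maximum, since a constant touches v from above at a
    local maximum. Some v(x + theta) lies above a paraboloid with vertex x; [increasing_direction]
    turns this into uniform growth along theta near x, and [increasing_level_set] makes the level
    set a graph over a hyperplane transversal to theta. Conversely, [lipschitz_graph_cone] shows
    that the side of the graph where v exceeds v(x) contains a cone. If 0 were in D^+v(x),
    [cone_small_subgradient] would give subgradients p with |p| arbitrarily small, and by
    [hamiltonian_upper] H(y, p) would fall below alpha(c). *)

Section dot_theory.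
Context {R : realType} {n : nat}.
Implicit Types p q r : 'cV[R]_n.

Lemma dotC p q : dot p q = dot q p.
Proof. by apply: eq_bigr => i _; rewrite mulrC. Qed.

Lemma dotDl p q r : dot (p + q) r = dot p r + dot q r.
Proof. by rewrite -big_split; apply: eq_bigr => i _; rewrite !mxE mulrDl. Qed.

Lemma dotZl (k : R) p q : dot (k *: p) q = k * dot p q.
Proof. by rewrite mulr_sumr; apply: eq_bigr => i _; rewrite !mxE mulrA. Qed.

Lemma dotNl p q : dot (- p) q = - dot p q.
Proof. by rewrite -scaleN1r dotZl mulN1r. Qed.

Lemma dotDr p q r : dot r (p + q) = dot r p + dot r q.
Proof. by rewrite !(dotC r) dotDl. Qed.

Lemma dotZr (k : R) p q : dot p (k *: q) = k * dot p q.
Proof. by rewrite !(dotC p) dotZl. Qed.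

Lemma dotNr p q : dot p (- q) = - dot p q.
Proof. by rewrite !(dotC p) dotNl. Qed.

Lemma dot0l p : dot 0 p = 0.
Proof. by rewrite -(scale0r 0) dotZl mul0r. Qed.

Definition dotE := (dotDl, dotDr, dotNl, dotNr, dotZl, dotZr).

Lemma dot_ge0 p : 0 <= dot p p.
Proof. by apply: sumr_ge0 => i _; rewrite -expr2 sqr_ge0. Qed.

Lemma dot_eq0 p : (dot p p == 0) = (p == 0).
Proof.
apply/eqP/eqP => [|->]; last by rewrite dot0l.
move/eqP; rewrite psumr_eq0 => [/allP h|i _]; last by rewrite -expr2 sqr_ge0.
apply/matrixP => i j; rewrite !mxE ord1.
by have := h i (mem_index_enum _); rewrite mulf_eq0 orbb => /eqP.
Qed.

Lemma enorm_ge0 p : 0 <= enorm p. Proof. exact: sqrtr_ge0. Qed.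

Lemma enorm_sqr p : enorm p ^+ 2 = dot p p.
Proof. by rewrite sqr_sqrtr// dot_ge0. Qed.

Lemma enorm_eq0 p : (enorm p == 0) = (p == 0).
Proof. by rewrite sqrtr_eq0 -dot_eq0 eq_le dot_ge0 andbT. Qed.

Lemma enorm_gt0 p : (0 < enorm p) = (p != 0).
Proof. by rewrite lt_neqAle enorm_ge0 andbT eq_sym enorm_eq0. Qed.

Lemma enormN p : enorm (- p) = enorm p.
Proof. by rewrite /enorm dotNl dotNr opprK. Qed.

Lemma enormZ (k : R) p : 0 <= k -> enorm (k *: p) = k * enorm p.
Proof.
by move=> k0; rewrite /enorm dotZl dotZr mulrA -expr2 sqrtrM ?sqr_ge0// sqrtr_sqr ger0_norm.
Qed.

Lemma cauchy_schwarz p q : dot p q <= enorm p * enorm q.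
Proof.
have [->|p0] := eqVneq p 0; first by rewrite dot0l mulr_ge0 ?enorm_ge0.
have [->|q0] := eqVneq q 0; first by rewrite dotC dot0l mulr_ge0 ?enorm_ge0.
have a0 : 0 < enorm p by rewrite enorm_gt0.
have b0 : 0 < enorm q by rewrite enorm_gt0.
have := dot_ge0 (enorm q *: p - enorm p *: q).
rewrite !dotE -(enorm_sqr p) -(enorm_sqr q) (dotC q p) => h.
have {}h : 0 <= (enorm p * enorm q) * (enorm p * enorm q - dot p q) by lra.
by move: h; rewrite pmulr_rge0 ?mulr_gt0// subr_ge0.
Qed.

Lemma norm_dot p q : `|dot p q| <= enorm p * enorm q.
Proof.
by rewrite ler_norml cauchy_schwarz andbT lerNl -dotNl -(enormN p) cauchy_schwarz.
Qed.

Lemma enormD p q : enorm (p + q) <= enorm p + enorm q.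
Proof.
rewrite -ler_sqr ?nnegrE ?addr_ge0 ?enorm_ge0// enorm_sqr.
rewrite !dotE -!enorm_sqr (dotC q p); have := cauchy_schwarz p q; lra.
Qed.

Lemma coord_le_enorm p i : `|p i 0| <= enorm p.
Proof.
rewrite -ler_sqr ?nnegrE ?enorm_ge0// enorm_sqr real_normK ?num_real//.
rewrite /dot (bigD1 i)//= -expr2 lerDl sumr_ge0// => j _.
by rewrite -expr2 sqr_ge0.
Qed.

Lemma coord_le_norm p i : `|p i 0| <= `|p|.
Proof.
rewrite [leRHS]/Num.norm /= mx_normrE.
by apply/bigmax_geP; right => /=; exists (i, ord0).
Qed.

Lemma norm_le p (k : R) : 0 <= k -> (forall i, `|p i 0| <= k) -> `|p| <= k.
Proof.
move=> k0 h; rewrite [leLHS]/Num.norm /= mx_normrE.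
by apply/bigmax_leP; split => // -[i j] _ /=; rewrite ord1.
Qed.

Lemma norm_le_enorm p : `|p| <= enorm p.
Proof. by apply: norm_le (enorm_ge0 p) _ => i; exact: coord_le_enorm. Qed.

Lemma dot_le_norm p q : `|dot p q| <= n%:R * (`|p| * `|q|).
Proof.
apply: le_trans (ler_norm_sum _ _ _) _.
rewrite mulr_natl -[X in _ *+ X]card_ord -sumr_const; apply: ler_sum => i _.
by rewrite normrM ler_pM// coord_le_norm.
Qed.

Lemma enorm_le_norm p : enorm p <= n%:R * `|p|.
Proof.
rewrite -ler_sqr ?nnegrE ?enorm_ge0// ?mulr_ge0// enorm_sqr.
apply: le_trans (ler_norm _) _; apply: le_trans (dot_le_norm p p) _.
rewrite -expr2 exprMn ler_wpM2r ?sqr_ge0//.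
by rewrite -natrX ler_nat -mulnn; case: (n) => // m; rewrite leq_pmulr.
Qed.

End dot_theory.

Lemma norm_continuousP {R : realType} {V W : normedModType R} (f : V -> W) :
  continuous f <-> forall x e, 0 < e ->
    exists2 d, 0 < d & forall y, `|y - x| < d -> `|f y - f x| < e.
Proof.
split=> [cf x e e0|cf x].
  have /cvgrPdist_lt/(_ _ e0)/nbhs_ballP[d /= d0 dP] := cf x.
  exists d => // y yd; rewrite distrC; apply: dP.
  by rewrite -ball_normE /ball_ /= distrC.
apply/cvgrPdist_lt => e e0; have [d d0 dP] := cf x e e0.
apply/nbhs_ballP; exists d => // y; rewrite -ball_normE /ball_ /= distrC => yd.
by rewrite distrC; exact: dP.
Qed.

Lemma cV_compact_box {R : realType} {n : nat} (a b : R) :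
  compact [set p : 'cV[R]_n | forall i, p i 0 \in `[a, b]].
Proof.
have -> : [set p : 'cV[R]_n | forall i, p i 0 \in `[a, b]] =
    trmx @` [set p : 'rV[R]_n | forall i, p ord0 i \in `[a, b]].
  apply/seteqP; split => [p /= hp|_ [p /= hp <-] i /=]; last by rewrite mxE.
  by exists p^T; [move=> i; rewrite mxE|rewrite trmxK].
apply: continuous_compact; last first.
  by apply: (@rV_compact _ _ (fun=> `[a, b]%classic)) => _; exact: segment_compact.
apply: continuous_subspaceT; apply/norm_continuousP => p e e0.
exists e => // q; have -> : q^T - p^T = (q - p)^T by rewrite linearB.
apply: le_lt_trans; apply: norm_le => // i; rewrite mxE.
rewrite [leRHS]/Num.norm /= mx_normrE.
by apply/bigmax_geP; right => /=; exists (ord0, i).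
Qed.

Lemma cV_compact_ball {R : realType} {n : nat} (r : R) :
  compact [set p : 'cV[R]_n | `|p| <= r].
Proof.
have [r0|r0] := leP 0 r; last first.
  have -> : [set p : 'cV[R]_n | `|p| <= r] = set0.
    apply/seteqP; split=> // p /= /le_lt_trans /(_ r0).
    by rewrite ltNge normr_ge0.
  exact: compact0.
have -> : [set p : 'cV[R]_n | `|p| <= r] =
    [set p : 'cV[R]_n | forall i, p i 0 \in `[- r, r]].
  apply/seteqP; split => [p /= hp i|p /= hp].
    by rewrite in_itv /= -ler_norml (le_trans (coord_le_norm _ _)).
  by apply: norm_le => // i; have := hp i; rewrite in_itv /= -ler_norml.
exact: cV_compact_box.
Qed.

Section semidifferentials.
Context {R : realType} {n : nat}.
Implicit Types (w : 'cV[R]_n -> R) (x y p : 'cV[R]_n).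

Lemma superdiff_le w x p : superdiff w x p ->
  forall e, 0 < e -> exists2 d, 0 < d &
    forall y, `|y - x| < d -> w y - w x - dot p (y - x) <= e * `|y - x|.
Proof.
rewrite /superdiff /= limf_esupE => hp e e0.
(* The factor [n.+1] pays for passing from the Euclidean norm to the sup norm and stays nonzero when
   [n] is 0. *)
have e'0 : (0 < e / n.+1%:R :> R) by rewrite divr_gt0.
have : (ereal_inf [set ereal_sup (diff_quotient w x p @` B) | B in x^'] < (e / n.+1%:R)%:E)%E.
  by apply: le_lt_trans hp _; rewrite lte_fin.
move=> /ereal_inf_lt[_ [B /= xB <-] hB].
move: xB => /nbhs_ballP[d /= d0 dB]; exists d => // y yd.
have [->|yx] := eqVneq y x.
  by rewrite !subrr (dotC p) dot0l normr0 subrr mulr0.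
have yB : B y by apply: dB => //; rewrite -ball_normE /ball_ /= distrC.
have := @ereal_sup_ubound R (diff_quotient w x p @` B) (diff_quotient w x p y).
move=> /(_ (ex_intro2 _ _ _ yB erefl)) /le_lt_trans /(_ hB).
rewrite /diff_quotient lte_fin ltr_pdivrMr ?enorm_gt0 ?subr_eq0// => /ltW h.
apply: (le_trans h); rewrite -mulrA ler_pM2l// mulrC ler_pdivrMr//.
apply: (le_trans (enorm_le_norm _)); rewrite mulrC ler_wpM2l// ler_nat //.
Qed.

(** A quadratic error is o(|y - x|). Every membership in D^+ is certified through this test,
    whatever the sign of [k]. *)
Lemma superdiff_quadratic w x p (k d : R) : 0 < d ->
  (forall y, `|y - x| < d -> w y - w x <= dot p (y - x) + k * dot (y - x) (y - x)) ->
  superdiff w x p.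
Proof.
move=> d0 h; rewrite /superdiff /= limf_esupE.
apply/lee_addgt0Pr => e e0; rewrite add0e.
pose k' := `|k| + 1; have k'0 : 0 < k' by rewrite ltr_wpDl.
apply: ereal_inf_le.
exists (ereal_sup (diff_quotient w x p @`
  [set y | y != x /\ enorm (y - x) < e / k' /\ `|y - x| < d])).
  exists [set y | y != x /\ enorm (y - x) < e / k' /\ `|y - x| < d] => //.
  apply/nbhs_ballP; exists (Num.min d (e / k' / n.+1%:R)) => /=.
    by rewrite lt_min d0 !divr_gt0.
  move=> y; rewrite -ball_normE /ball_ /= distrC lt_min => /andP[h1 h2] yx.
  split => //; split => //; apply: le_lt_trans (enorm_le_norm _) _.
  move: h2; rewrite ltr_pdivlMr// mulrC; apply: le_lt_trans.
  by rewrite ler_wpM2r// ler_nat.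
apply: ge_ereal_sup => _ [y [yx [h1 h2]] <-].
have E0 : 0 < enorm (y - x) by rewrite enorm_gt0 subr_eq0.
rewrite /diff_quotient lee_fin ler_pdivrMr//.
have := h y h2; rewrite -enorm_sqr => h3.
have h4 : k' * enorm (y - x) <= e by rewrite mulrC -ler_pdivlMr// ltW.
have h5 : k <= k' by rewrite (le_trans (ler_norm k))// lerDl.
have h6 : k * enorm (y - x) <= e by apply: le_trans h4; rewrite ler_pM2r.
have : k * enorm (y - x) * enorm (y - x) <= e * enorm (y - x) by rewrite ler_pM2r.
lra.
Qed.

Lemma subdiff_quadratic w x p (k d : R) : 0 < d ->
  (forall y, `|y - x| < d -> dot p (y - x) - k * dot (y - x) (y - x) <= w y - w x) ->
  subdiff w x p.
Proof.
move=> d0 h; rewrite /subdiff /= /limf_einf leeNr oppe0.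
have -> : (\- diff_quotient w x p)%E = diff_quotient (fun y => - w y) x (- p).
  apply/funext => y; rewrite /diff_quotient -EFinN -mulNr dotNl; congr (_ / _)%:E.
  lra.
by apply: (@superdiff_quadratic _ _ _ k d) => // y /h; rewrite dotNl; lra.
Qed.

Lemma diff_quotient_add_linear w (c : 'cV[R]_n) x p :
  diff_quotient (fun y => w y + dot c y) x (c + p) = diff_quotient w x p.
Proof.
apply/funext => y; rewrite /diff_quotient !dotE; congr (_ / _)%:E; lra.
Qed.

End semidifferentials.

(** * Periodic functions of class C^1 and C^2 *)

Section periodic_functions.
Context {R : realType} {n : nat}.
Implicit Types (F w : 'cV[R]_n -> R) (x y z a : 'cV[R]_n).

Lemma translate_to_unit_cube x :
  exists k : 'cV[int]_n, forall i, (x + map_mx intr k) i 0 \in `[0, 1].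
Proof.
exists (\col_i - Num.floor (x i 0)) => i; rewrite !mxE in_itv /= rmorphN /=.
have := floor_le (x i 0); have := floorD1_gt (x i 0); rewrite intrD; lra.
Qed.

Lemma Zn_periodic_bounded F : continuous F -> Zn_periodic F ->
  exists2 M, 0 <= M & forall x, `|F x| <= M.
Proof.
move=> cF pF; have cc := @cV_compact_box R n 0 1.
have ne : [set p : 'cV[R]_n | forall i, p i 0 \in `[0, 1]] !=set0.
  by exists 0 => i /=; rewrite !mxE in_itv /= lexx ler01.
have [|c _ cP] := compact_EVT_max (f := fun x => `|F x|) ne cc.
  apply: continuous_subspaceT => x; apply: continuous_comp; first exact: cF.
  exact: norm_continuous.
exists `|F c| => // x; have [k kP] := translate_to_unit_cube x.
by rewrite -(pF x k); have /= -> := cP (x + map_mx intr k); rewrite ?inE.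
Qed.

Lemma Zn_periodic_derive F a : Zn_periodic F ->
  Zn_periodic (fun x => 'D_a F x).
Proof.
move=> pF x k; rewrite /derive /=; set g := (X in lim (X @ _)); set h := (X in _ = lim (X @ _)).
suff -> : g = h by [].
by apply/funext => t; rewrite /g /h /= addrA !pF.
Qed.

Lemma line_derive F a z (t : R) : derivable F (z + t *: a) a ->
  is_derive t (1 : R) (fun s : R => F (z + s *: a)) ('D_a F (z + t *: a)).
Proof.
have E : (fun h : R => h^-1 *: (((fun s : R => F (z + s *: a)) \o shift t)
    (h *: (1 : R)) - F (z + t *: a)))
  = (fun h => h^-1 *: ((F \o shift (z + t *: a)) (h *: a) - F (z + t *: a))).
  apply/funext => h /=; congr (_ *: (F _ - _)).
  by rewrite scalerDl [h *: 1]mulr1 addrCA.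
by move=> dF; constructor; rewrite /derivable /derive /= E.
Qed.

Lemma line_MVT F a z (s : R) : continuous F -> (forall x, derivable F x a) ->
  exists2 t : R, `|t| <= `|s| & F (z + s *: a) - F z = s * 'D_a F (z + t *: a).
Proof.
move=> cF dF.
have cg : continuous (fun s : R => F (z + s *: a)).
  move=> t; apply: continuous_comp; last exact: cF.
  apply: cvgD; first exact: cvg_cst.
  exact: scalel_continuous.
have D (t : R) : is_derive t (1 : R) (fun s : R => F (z + s *: a)) ('D_a F (z + t *: a)).
  exact: line_derive.
have [s0|s0] := leP 0 s.
  have [t] := @MVT_segment R _ (fun t => 'D_a F (z + t *: a)) 0 s s0
    (fun t _ => D t) (continuous_subspaceT cg).
  rewrite in_itv /= => /andP[t0 ts]; rewrite scale0r addr0 subr0 => h.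
  by exists t; [rewrite (ger0_norm t0) (ger0_norm s0)|rewrite h mulrC].
have [t] := @MVT_segment R _ (fun t => 'D_a F (z + t *: a)) s 0 (ltW s0)
    (fun t _ => D t) (continuous_subspaceT cg).
rewrite in_itv /= => /andP[ts t0]; rewrite scale0r addr0 => h.
exists t; first by rewrite (ler0_norm t0) (ltr0_norm s0) lerN2.
by rewrite -[LHS]opprB h sub0r mulrN opprK mulrC.
Qed.

(** Moving one coordinate at a time reduces the increment to one-variable mean value theorems, so
    partial derivatives suffice; the price is a different intermediate point for each coordinate. *)
Lemma mean_value_sum F x a : Ck 1 F ->
  exists2 xi : 'I_n -> 'cV[R]_n, (forall i, `|xi i - x| <= `|a|) &
    F (x + a) - F x = \sum_(i < n) a i 0 * 'D_(delta_mx i 0) F (xi i).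
Proof.
move=> [cF dF].
(* [tr j] keeps the first [j] coordinates of [a]; these are the corners of the path from 0 to
   [a]. *)
pose tr j : 'cV[R]_n := \col_i (if (i < j)%N then a i 0 else 0).
have trS (i : 'I_n) : tr i.+1 = tr i + a i 0 *: delta_mx i 0.
  apply/matrixP => j k; rewrite !mxE ord1 eqxx andbT ltnS leq_eqVlt.
  have [->|ji] := eqVneq j i; first by rewrite eqxx ltnn add0r mulr1.
  by rewrite -val_eqE /= in ji; rewrite (negPf ji) /= mulr0 addr0.
have h (i : 'I_n) : exists xi, `|xi - x| <= `|a| /\
    F (x + tr i.+1) - F (x + tr i) = a i 0 * 'D_(delta_mx i 0) F xi.
  have [t ta E] := line_MVT (x + tr i) (a i 0) cF (dF i).1.
  exists (x + tr i + t *: delta_mx i 0); split; last by rewrite trS addrA.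
  have -> : x + tr i + t *: delta_mx i 0 - x = tr i + t *: delta_mx i 0.
    by apply/matrixP => j k; rewrite !mxE; lra.
  apply: norm_le => // j; rewrite !mxE eqxx andbT.
  have [->|ji] := eqVneq j i.
    by rewrite ltnn add0r mulr1 (le_trans ta)// coord_le_norm.
  by rewrite mulr0 addr0; case: ifP; rewrite ?normr0// coord_le_norm.
have [xi xiP] := choice h.
exists xi => [i|]; first by have [] := xiP i.
transitivity (\sum_(i < n) (F (x + tr i.+1) - F (x + tr i))).
  rewrite -(big_mkord xpredT (fun i => F (x + tr i.+1) - F (x + tr i))).
  rewrite telescope_sumr//; congr (F (x + _) - F _).
    by apply/matrixP => i j; rewrite !mxE ltn_ord ord1.
  by apply/matrixP => i j; rewrite !mxE addr0.
by apply: eq_bigr => i _; have [] := xiP i.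
Qed.

Lemma C1_periodic_lipschitz F : Ck 1 F -> Zn_periodic F ->
  exists2 K, 0 <= K & forall x y, `|F x - F y| <= K * `|x - y|.
Proof.
move=> C1 pF; have [cF dF] := C1.
have h i := Zn_periodic_bounded (dF i).2 (Zn_periodic_derive (delta_mx i 0) pF).
have /choice[M MP] : forall i, exists M, 0 <= M /\ forall x, `|'D_(delta_mx i 0) F x| <= M.
  by move=> i; have [M M0 MP] := h i; exists M.
exists (\sum_i M i) => [|x y]; first by apply: sumr_ge0 => i _; have [] := MP i.
have [xi _] := mean_value_sum y (x - y) C1; rewrite [y + _]addrC subrK => ->.
apply: le_trans (ler_norm_sum _ _ _) _; rewrite mulr_suml; apply: ler_sum => i _.
have [Mi MiP] := MP i.
by rewrite normrM mulrC ler_pM// coord_le_norm.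
Qed.

Lemma C2_periodic_second_difference F : Ck 2 F -> Zn_periodic F ->
  exists2 K, 0 <= K & forall x y z,
    `|F x + F z - 2 * F y| <= K * (`|x + z - 2 *: y| + `|x - z| ^+ 2).
Proof.
move=> C2 pF.
have C1 : Ck 1 F.
  by move: C2 => /= -[cF dF]; split => // i; have [d [c _]] := dF i.
have [K1 K10 K1P] := C1_periodic_lipschitz C1 pF.
have h i := C1_periodic_lipschitz (C2.2 i).2 (Zn_periodic_derive (delta_mx i 0) pF).
have /choice[M MP] : forall i, exists M, 0 <= M /\ forall x y,
    `|'D_(delta_mx i 0) F x - 'D_(delta_mx i 0) F y| <= M * `|x - y|.
  by move=> i; have [M M0 MP] := h i; exists M.
have S0 : 0 <= \sum_i M i by apply: sumr_ge0 => i _; have [] := MP i.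
exists (K1 + \sum_i M i) => [|x y z]; first exact: addr_ge0.
(* Through the midpoint [m], the expression splits into a centred second difference with step [a],
   controlled by Lipschitz first derivatives, and 2 (F m - F y), controlled by the Lipschitz bound
   on F. *)
pose m := 2^-1 *: (x + z); pose a := 2^-1 *: (x - z).
have Ea : `|a| = 2^-1 * `|x - z| by rewrite normrZ ger0_norm.
have Ex : x = m + a by apply/matrixP => i j; rewrite !mxE; lra.
have Em : m = z + a by apply/matrixP => i j; rewrite !mxE; lra.
have [xi xiP Exi] := mean_value_sum m a C1.
have [ze zeP Eze] := mean_value_sum z a C1.
have -> : F x + F z - 2 * F y =
   (\sum_i a i 0 * ('D_(delta_mx i 0) F (xi i) - 'D_(delta_mx i 0) F (ze i)))
   + 2 * (F m - F y).
  under eq_bigr do rewrite mulrBr; rewrite sumrB -Exi -Eze -Em -Ex; lra.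
have h1 : `|2 * (F m - F y)| <= K1 * `|x + z - 2 *: y|.
  have -> : `|x + z - 2 *: y| = 2 * `|m - y|.
    by rewrite -{2}(@ger0_norm _ (2 : R))// -normrZ scalerBr scalerA mulfV// scale1r.
  by rewrite normrM ger0_norm// mulrCA ler_pM2l.
apply: (le_trans (ler_normD _ _)).
have h2 : `|\sum_i a i 0 * ('D_(delta_mx i 0) F (xi i) - 'D_(delta_mx i 0) F (ze i))|
    <= (\sum_i M i) * `|x - z| ^+ 2.
  apply: le_trans (ler_norm_sum _ _ _) _; rewrite mulr_suml; apply: ler_sum => i _.
  have [Mi0 MiP] := MP i.
  rewrite normrM; have ai := coord_le_norm a i.
  have d : `|xi i - ze i| <= 3 * `|a|.
    have -> : xi i - ze i = (xi i - m) - (ze i - z) + a 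
      by apply/matrixP => j k; rewrite Em !mxE; lra.
    apply: le_trans (ler_normD _ _) _.
    have := ler_normB (xi i - m) (ze i - z); have := xiP i; have := zeP i; lra.
  have e := le_trans (MiP (xi i) (ze i)) (ler_wpM2l Mi0 d).
  apply: le_trans (ler_pM _ _ ai e) _ => //.
  have : 0 <= M i * `|x - z| ^+ 2 by rewrite mulr_ge0// sqr_ge0.
  rewrite Ea; lra.
have : 0 <= K1 * `|x - z| ^+ 2 by rewrite mulr_ge0// sqr_ge0.
have : 0 <= (\sum_i M i) * `|x + z - 2 *: y| by rewrite mulr_ge0.
lra.
Qed.

End periodic_functions.

(** * The Hamiltonian *)

Section quadratic_forms.
Context {R : realType} {n : nat}.
Implicit Types (B : 'M[R]_n) (p q r : 'cV[R]_n).

Lemma dot_mulmx B q r : dot (B *m q) r = \sum_(i < n) \sum_(j < n) B i j * q j 0 * r i 0.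
Proof. by apply: eq_bigr => i _; rewrite mxE mulr_suml. Qed.

Lemma dot_mulmx_le B q r (b : R) : (forall i j, `|B i j| <= b) ->
  `|dot (B *m q) r| <= n%:R ^+ 2 * b * (enorm q * enorm r).
Proof.
move=> hB; rewrite dot_mulmx; apply: le_trans (ler_norm_sum _ _ _) _.
have -> : n%:R ^+ 2 * b * (enorm q * enorm r) =
    \sum_(i < n) \sum_(j < n) b * (enorm q * enorm r).
  by rewrite !sumr_const card_ord -mulrnA -[RHS]mulr_natl natrM -expr2 -[LHS]mulrA.
apply: ler_sum => i _; apply: le_trans (ler_norm_sum _ _ _) _.
apply: ler_sum => j _; rewrite 2!normrM -mulrA.
by apply: ler_pM => //; apply: ler_pM => //; exact: coord_le_enorm.
Qed.

Lemma dot_mulmx_sym B q r : B \is symmetricmx -> dot (B *m q) r = dot (B *m r) q.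
Proof.
rewrite qualifE /= expr0 scale1r => /eqP hB.
rewrite !dot_mulmx exchange_big /=; apply: eq_bigr => i _; apply: eq_bigr => j _.
by rewrite {1}hB !mxE mulrAC.
Qed.

End quadratic_forms.

Section hamiltonian_estimates.
Context {R : realType} {n : nat}.
Variables (A : 'cV[R]_n -> 'M[R]_n) (V : 'cV[R]_n -> R).
Hypotheses (A_sym_posdef : forall x, sym_posdef (A x)).
Hypotheses (A_smooth : smooth_mx A) (A_periodic : Zn_periodic A).
Hypotheses (V_smooth : smooth V) (V_periodic : Zn_periodic V).
Implicit Types (x y z p q r : 'cV[R]_n).
Local Notation H := (hamiltonian A V).

Lemma entry_periodic i j : Zn_periodic (fun x => A x i j).
Proof. by move=> x k; rewrite A_periodic. Qed.

(** By compactness the form has a positive minimum over the unit cube times the sup-norm unit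
    sphere; periodicity and homogeneity carry it to all points and vectors. *)
Lemma uniformly_elliptic :
  exists2 lam, 0 < lam & forall x p, lam * dot p p <= dot (A x *m p) p.
Proof.
pose S := [set p : 'cV[R]_n | `|p| = 1].
pose Q := [set x : 'cV[R]_n | forall i, x i 0 \in `[0, 1]].
(* An empty sphere means that 0 is the only vector, and any constant will do. *)
have [[p0 p01]|S0] := pselect (S !=set0); last first.
  exists 1 => // x p; have [->|pn0] := eqVneq p 0; first by rewrite mulmx0 !dot0l mulr0.
  exfalso; apply: S0; exists (`|p|^-1 *: p); rewrite /S /= normrZ normrV ?unitfE ?normr_eq0//.
  by rewrite normr_id mulVf// normr_eq0.
have cS : compact S.
  apply: subclosed_compact _ (@cV_compact_ball R n 1) _; last by move=> p /= ->.
  exact: (@preimage_closed 'cV[R]_n R (fun p => `|p|) [set x | x = 1]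
    (fun x _ => @norm_continuous _ _ x) (@closed_eq R 1)).
have cQS := compact_setX (@cV_compact_box R n 0 1) cS.
have ne : Q `*` S !=set0.
  by exists (0, p0); split => //= i; rewrite !mxE in_itv /= lexx ler01.
have [|[x0 p1]] := compact_EVT_min (f := fun t => dot (A t.1 *m t.2) t.2) ne cQS.
  apply: continuous_subspaceT => t.
  rewrite (_ : (fun _ => _) = (fun t : 'cV[R]_n * 'cV[R]_n =>
    \sum_(i < n) \sum_(j < n) A t.1 i j * t.2 j 0 * t.2 i 0)); last first.
    by apply/funext => s; rewrite dot_mulmx.
  have c2 i : (fun t : 'cV[R]_n * 'cV[R]_n => t.2 i 0) x @[x --> t] --> t.2 i 0.
    apply: (@cvg_comp _ _ _ (fun t : 'cV[R]_n * 'cV[R]_n => t.2) (fun p : 'cV[R]_n => p i 0)).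
      exact: cvg_snd.
    exact: coord_continuous.
  apply: cvg_big => [|i _]; first exact: add_continuous.
  apply: cvg_big => [|j _]; first exact: add_continuous.
  apply: cvgM; last exact: c2.
  apply: cvgM; last exact: c2.
  apply: (@cvg_comp _ _ _ (fun t : 'cV[R]_n * 'cV[R]_n => t.1) (fun x => A x i j)).
    exact: cvg_fst.
  exact: (A_smooth i j 0).
rewrite inE => -[/= x0Q p1S] hm.
set m := dot (A x0 *m p1) p1 in hm.
have m0 : 0 < m.
  apply: (A_sym_posdef x0).2; apply/eqP => p10; move: p1S; rewrite /S /= p10 normr0.
  by move/eqP; rewrite eq_sym oner_eq0.
exists (m / n.+1%:R) => [|x p]; first by rewrite divr_gt0.
have [->|pn0] := eqVneq p 0; first by rewrite mulmx0 !dot0l mulr0.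
have [k kP] := translate_to_unit_cube x.
have np : 0 < `|p| by rewrite normr_gt0.
have := hm (x + map_mx intr k, `|p|^-1 *: p).
rewrite inE /= => /(_ _) h; have {}h := h (conj _ _).
have {}h : m <= dot (A (x + map_mx intr k) *m (`|p|^-1 *: p)) (`|p|^-1 *: p).
  apply: h => //; rewrite /S /= normrZ normrV ?unitfE ?normr_eq0//.
  by rewrite normr_id mulVf// normr_eq0.
move: h; rewrite A_periodic -scalemxAr dotZl dotZr mulrA -invfM mulrC ler_pdivlMr ?mulr_gt0//.
apply: le_trans; rewrite -mulrA ler_pM2l// mulrC ler_pdivrMr// mulrC.
apply: le_trans (ler_norm _) _; apply: le_trans (dot_le_norm _ _) _.
by rewrite ler_wpM2r ?mulr_ge0// ler_nat.
Qed.

Lemma entries_bounded : exists2 L, 0 <= L & forall x i j, `|A x i j| <= L.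
Proof.
have /choice[M MP] : forall ij : 'I_n * 'I_n, exists M, 0 <= M /\ forall x, `|A x ij.1 ij.2| <= M.
  move=> [i j]; have [M M0 MP] := Zn_periodic_bounded (A_smooth i j 0) (entry_periodic i j).
  by exists M.
exists (\sum_ij M ij) => [|x i j]; first by apply: sumr_ge0 => i _; have [] := MP i.
apply: le_trans ((MP (i, j)).2 x) _; rewrite (bigD1 (i, j))//= lerDl.
by apply: sumr_ge0 => ij _; have [] := MP ij.
Qed.

Lemma hamiltonian_upper : exists2 L, 0 <= L &
  forall x p, H x p <= V x + L * enorm p ^+ 2.
Proof.
have [L L0 LP] := entries_bounded.
exists (n%:R ^+ 2 * L) => [|x p]; first by rewrite mulr_ge0// sqr_ge0.
rewrite /hamiltonian addrC lerD2l.
have := dot_mulmx_le p p (LP x); have := ler_norm (dot (A x *m p) p).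
have : 0 <= n%:R ^+ 2 * L * enorm p ^+ 2.
  by apply: mulr_ge0; [apply: mulr_ge0|]; rewrite ?sqr_ge0.
rewrite -expr2; lra.
Qed.

Lemma hamiltonian_coercive (a : R) : exists2 M, 0 <= M &
  forall x p, H x p <= a -> enorm p <= M.
Proof.
have [lam lam0 lamP] := uniformly_elliptic.
have [m m0 mP] := Zn_periodic_bounded (V_smooth 0) V_periodic.
have b0 : 0 <= 2 * (`|a| + m) / lam.
  by apply: divr_ge0; [rewrite mulr_ge0 ?addr_ge0|exact: ltW].
exists (Num.sqrt (2 * (`|a| + m) / lam)) => [|x p hp]; first exact: sqrtr_ge0.
rewrite -ler_sqr ?nnegrE ?enorm_ge0 ?sqrtr_ge0// enorm_sqr sqr_sqrtr//.
rewrite ler_pdivlMr// mulrC; apply: le_trans (lamP x p) _.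
move: hp; rewrite /hamiltonian; have := ler_norm a; have := mP x.
rewrite ler_norml => /andP[]; lra.
Qed.

(** Quantitative convexity in p with moving base points: ellipticity makes the part quadratic in [r]
    at least lam |r|^2, the second differences of A and V cost |x + z - 2y| + |x - z|^2, and the
    cross term in [q] and [r] involves only the first difference A(x) - A(z). *)
Lemma hamiltonian_second_difference : exists2 lam, 0 < lam & exists2 K, 0 <= K &
  forall x y z q r,
    lam * enorm r ^+ 2 - K * ((enorm q ^+ 2 + 1) * (enorm (x + z - 2 *: y) + enorm (x - z) ^+ 2)
      + enorm (x - z) * enorm q * enorm r) <=
    H x (q + r) + H z (q - r) - 2 * H y q.
Proof.
have [lam lam0 lamP] := uniformly_elliptic.
have /choice[M MP] : forall ij : 'I_n * 'I_n, exists M, 0 <= M /\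
    (forall x y, `|A x ij.1 ij.2 - A y ij.1 ij.2| <= M * enorm (x - y)) /\
    (forall x y z, `|A x ij.1 ij.2 + A z ij.1 ij.2 - 2 * A y ij.1 ij.2| <=
      M * (enorm (x + z - 2 *: y) + enorm (x - z) ^+ 2)).
  move=> [i j]; have C2 := A_smooth i j 2; have C1 := A_smooth i j 1.
  have [M1 M10 M1P] := C1_periodic_lipschitz C1 (entry_periodic i j).
  have [M2 M20 M2P] := C2_periodic_second_difference C2 (entry_periodic i j).
  exists (M1 + M2); split; first exact: addr_ge0.
  split=> [x y|x y z] /=.
    apply: le_trans (M1P x y) _; apply: ler_pM => //; first by rewrite lerDl.
    exact: norm_le_enorm.
  apply: le_trans (M2P x y z) _; apply: ler_pM => //.
  - by rewrite lerDr.
  - by rewrite lerD ?norm_le_enorm// ler_sqr ?nnegrE ?enorm_ge0 ?norm_le_enorm.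
have [KV KV0 KVP] := C2_periodic_second_difference (V_smooth 2) V_periodic.
pose N := \sum_ij M ij.
have N0 : 0 <= N by apply: sumr_ge0 => i _; have [] := MP i.
have MN ij : M ij <= N.
  by rewrite /N (bigD1 ij)//= lerDl; apply: sumr_ge0 => j _; have [] := MP j.
pose K := n%:R ^+ 2 * N.
have K0 : 0 <= K by rewrite mulr_ge0 ?sqr_ge0.
exists lam => //; exists (K + KV) => [|x y z q r]; first exact: addr_ge0.
set s := enorm (x + z - 2 *: y); set d := enorm (x - z).
have s0 : 0 <= s := enorm_ge0 _.
have d0 : 0 <= d := enorm_ge0 _.
have w0 : 0 <= s + d ^+ 2 by rewrite addr_ge0 ?sqr_ge0.
have h1 : `|dot ((A x + A z - 2 *: A y) *m q) q| <= K * (s + d ^+ 2) * (enorm q * enorm q).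
  rewrite /K -(mulrA _ N); apply: dot_mulmx_le => i j; rewrite !mxE.
  apply: le_trans ((MP (i, j)).2.2 x y z) _; exact: ler_wpM2r.
have h2 : `|dot ((A x - A z) *m q) r| <= K * d * (enorm q * enorm r).
  rewrite /K -(mulrA _ N); apply: dot_mulmx_le => i j; rewrite !mxE.
  apply: le_trans ((MP (i, j)).2.1 x z) _; exact: ler_wpM2r.
have h3 := lamP x r; have h4 := lamP z r.
have h5 : `|V x + V z - 2 * V y| <= KV * (s + d ^+ 2).
  apply: le_trans (KVP x y z) _; apply: ler_wpM2l => //.
  by rewrite lerD ?norm_le_enorm// ler_sqr ?nnegrE ?enorm_ge0 ?norm_le_enorm.
have E : H x (q + r) + H z (q - r) - 2 * H y q =
   2^-1 * dot ((A x + A z - 2 *: A y) *m q) q + dot ((A x - A z) *m q) r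
   + 2^-1 * (dot (A x *m r) r + dot (A z *m r) r) + (V x + V z - 2 * V y).
  rewrite /hamiltonian !mulmxDl !mulNmx -scalemxAl !mulmxDr !mulmxN !dotE.
  rewrite (dot_mulmx_sym r q (A_sym_posdef x).1) (dot_mulmx_sym r q (A_sym_posdef z).1).
  by field.
rewrite E.
move: h1 h2 h5; rewrite !ler_norml => /andP[h1 _] /andP[h2 _] /andP[h5 _].
have e1 : 0 <= K * (s + d ^+ 2) * (enorm q * enorm q) by rewrite !mulr_ge0 ?enorm_ge0.
have e2 : 0 <= KV * (s + d ^+ 2) * (enorm q * enorm q) by rewrite !mulr_ge0 ?enorm_ge0.
have e3 : 0 <= K * (s + d ^+ 2) by rewrite mulr_ge0.
have e4 : 0 <= KV * d * (enorm q * enorm r) by rewrite !mulr_ge0 ?enorm_ge0.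
rewrite -(enorm_sqr r) in h3 h4.
have -> : (K + KV) * ((enorm q ^+ 2 + 1) * (s + d ^+ 2) + d * enorm q * enorm r) =
  K * (s + d ^+ 2) * (enorm q * enorm q) + KV * (s + d ^+ 2) * (enorm q * enorm q)
  + K * (s + d ^+ 2) + KV * (s + d ^+ 2) + K * d * (enorm q * enorm r)
  + KV * d * (enorm q * enorm r) by ring.
lra.
Qed.

End hamiltonian_estimates.

(** * Lipschitz continuity and semiconcavity of viscosity solutions *)

Lemma cvg_dot {R : realType} {n : nat} {T : topologicalType} (f g : T -> 'cV[R]_n) (t : T) :
  {for t, continuous f} -> {for t, continuous g} ->
  {for t, continuous (fun x => dot (f x) (g x))}.
Proof.
move=> cf cg; rewrite /continuous_at /dot.
apply: cvg_big => [|i _]; first exact: add_continuous.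
apply: cvgM.
  by apply: (@cvg_comp _ _ _ f (fun p : 'cV[R]_n => p i 0)); [exact: cf|exact: coord_continuous].
by apply: (@cvg_comp _ _ _ g (fun p : 'cV[R]_n => p i 0)); [exact: cg|exact: coord_continuous].
Qed.

Section penalty.
Context {R : realType} {n : nat}.
Implicit Types (x y z d s e : 'cV[R]_n) (v : 'cV[R]_n -> R).

(* With d = x - z and s = x + z - 2y, the homogeneity s ~ d^2 makes the penalty *)
(* quadratic on centred differences, linear on (x, y, x), and smooth away from  *)
(* x = y = z.                                                                   *)
Definition penalty x y z : R :=
  Num.sqrt (dot (x - z) (x - z) ^+ 2 + dot (x + z - 2 *: y) (x + z - 2 *: y)).

Lemma penalty_arg_ge0 x y z :
  0 <= dot (x - z) (x - z) ^+ 2 + dot (x + z - 2 *: y) (x + z - 2 *: y).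
Proof. by rewrite addr_ge0 ?sqr_ge0 ?dot_ge0. Qed.

Lemma penalty_sqr x y z : penalty x y z ^+ 2 =
  enorm (x - z) ^+ 4 + enorm (x + z - 2 *: y) ^+ 2.
Proof. by rewrite sqr_sqrtr ?penalty_arg_ge0// -!enorm_sqr -exprM. Qed.

Lemma penalty_ge0 x y z : 0 <= penalty x y z.
Proof. exact: sqrtr_ge0. Qed.

Lemma penaltyC x y z : penalty x y z = penalty z y x.
Proof. by rewrite /penalty -(opprB x z) dotNl dotNr opprK (addrC x z). Qed.

Lemma enorm_le_penalty x y z : enorm (x + z - 2 *: y) <= penalty x y z.
Proof.
rewrite -ler_sqr ?nnegrE ?enorm_ge0 ?penalty_ge0// penalty_sqr lerDr.
by rewrite exprn_ge0 ?enorm_ge0.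
Qed.

Lemma enorm_sqr_le_penalty x y z : enorm (x - z) ^+ 2 <= penalty x y z.
Proof.
by rewrite -ler_sqr ?nnegrE ?sqr_ge0 ?penalty_ge0// penalty_sqr -exprM lerDl sqr_ge0.
Qed.

Lemma penalty_diag x y : penalty x y x = 2 * enorm (x - y).
Proof.
rewrite /penalty subrr dot0l expr0n add0r.
have -> : x + x - 2 *: y = 2 *: (x - y) by apply/matrixP => i j; rewrite !mxE; ring.
exact: enormZ.
Qed.

Lemma penalty_midpoint x h : penalty (x + h) x (x - h) = 4 * dot h h.
Proof.
rewrite /penalty.
have -> : x + h + (x - h) - 2 *: x = 0 by apply/matrixP => i j; rewrite !mxE; ring.
have -> : x + h - (x - h) = 2 *: h by apply/matrixP => i j; rewrite !mxE; ring.
rewrite dot0l addr0 sqrtr_sqr !dotE ger0_norm; first by ring.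
by rewrite !mulr_ge0// dot_ge0.
Qed.

(** Concavity of the square root. It replaces the penalty by a polynomial majorant that touches it
    at the base point. *)
Lemma sqrt_tangent (X Y : R) : 0 < X -> 0 <= Y ->
  Num.sqrt Y - Num.sqrt X <= (Y - X) / (2 * Num.sqrt X).
Proof.
move=> X0 Y0; have sX : 0 < Num.sqrt X by rewrite sqrtr_gt0.
rewrite ler_pdivlMr ?mulr_gt0// -{2}(sqr_sqrtr Y0) -{3}(sqr_sqrtr (ltW X0)).
have := sqr_ge0 (Num.sqrt Y - Num.sqrt X); rewrite sqrrB; lra.
Qed.

(** The vector is C times the gradient of the penalty in its first variable. By maximality the
    increments of v are at most those of C times the penalty, which [sqrt_tangent] bounds by a
    quadratic polynomial. *)
Lemma penalized_superdiff v (C : R) x y z : 0 <= C -> 0 < penalty x y z ->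
  (forall x', v x' - C * penalty x' y z <= v x - C * penalty x y z) ->
  superdiff v x ((C / penalty x y z) *:
    ((x + z - 2 *: y) + (2 * enorm (x - z) ^+ 2) *: (x - z))).
Proof.
move=> C0 P0 hmax; set P := penalty x y z in P0 *.
pose k : R := 10 * enorm (x - z) ^+ 2 + 2 * n%:R ^+ 2 + 1.
apply: (@superdiff_quadratic _ _ _ _ _ (C / (2 * P) * k) 1) => // x' x'1.
set e := x' - x in x'1 *.
have Ex' : x' = x + e by rewrite /e addrC subrK.
clearbody e.
have CP : 0 <= C / (2 * P) by rewrite divr_ge0// mulr_ge0// ltW.
apply: (@le_trans _ _ (C * (penalty x' y z - P))).
  by have := hmax x'; rewrite -/P; lra.
have X0 : 0 < dot (x - z) (x - z) ^+ 2 + dot (x + z - 2 *: y) (x + z - 2 *: y).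
  by rewrite -sqrtr_gt0.
have := sqrt_tangent X0 (penalty_arg_ge0 x' y z).
rewrite -/(penalty x y z) -/(penalty x' y z) -/P => /(ler_wpM2l C0) h.
apply: (le_trans h).
set Y := _ ^+ 2 + _; set X := _ ^+ 2 + _.
have -> : C * ((Y - X) / (2 * P)) = C / (2 * P) * (Y - X).
  by rewrite mulrA (mulrAC C).
have -> : dot ((C / P) *: (x + z - 2 *: y + (2 * enorm (x - z) ^+ 2) *: (x - z))) e
    + C / (2 * P) * k * dot e e =
   C / (2 * P) * (2 * dot (x + z - 2 *: y) e + 4 * dot (x - z) (x - z) * dot (x - z) e
     + k * dot e e).
  rewrite dotZl dotDl dotZl enorm_sqr; field; exact: lt0r_neq0.
apply: ler_wpM2l => //; rewrite /X /Y /k.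
have -> : x' + z - 2 *: y = (x + z - 2 *: y) + e.
  by rewrite Ex'; apply/matrixP => i j; rewrite !mxE; ring.
have -> : x' - z = (x - z) + e.
  by rewrite Ex'; apply/matrixP => i j; rewrite !mxE; ring.
move: (x - z) (x + z - 2 *: y) => d s.
rewrite !(dotDl, dotDr) (dotC e d) (dotC e s) enorm_sqr.
have h1 : dot d e ^+ 2 <= dot d d * dot e e.
  rewrite -!enorm_sqr -exprMn -real_normK ?num_real// ler_sqr ?nnegrE ?norm_dot//.
  by rewrite mulr_ge0 ?enorm_ge0.
have h2 : dot e e ^+ 2 <= n%:R ^+ 2 * dot e e.
  rewrite expr2 ler_wpM2r ?dot_ge0// -enorm_sqr ler_sqr ?nnegrE ?enorm_ge0//.
  apply: le_trans (enorm_le_norm e) _.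
  by rewrite -[leRHS]mulr1 ler_wpM2l// ltW.
have := sqr_ge0 (2 * dot d e - dot e e); rewrite sqrrB exprMn => h3.
have -> : (dot d d + dot d e + (dot d e + dot e e)) ^+ 2 =
  dot d d ^+ 2 + 4 * dot d d * dot d e + 2 * dot d d * dot e e +
  (4 * dot d e ^+ 2 + 4 * dot d e * dot e e + dot e e ^+ 2) by ring.
lra.
Qed.

(** The gradient of the penalty in y is -2 (x + z - 2y) / P, and the weight 2 of v(y) cancels the
    factor 2. *)
Lemma penalized_subdiff v (C : R) x y z : 0 <= C -> 0 < penalty x y z ->
  (forall y', 2 * v y + C * penalty x y z <= 2 * v y' + C * penalty x y' z) ->
  subdiff v y ((C / penalty x y z) *: (x + z - 2 *: y)).
Proof.
move=> C0 P0 hmin; set P := penalty x y z in P0 *.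
apply: (@subdiff_quadratic _ _ _ _ _ (C / P) 1) => // y' _.
set e := y' - y.
have CP : 0 <= C / P by rewrite divr_ge0// ltW.
apply: (@le_trans _ _ (- (C / 2 * (penalty x y' z - P)))); last first.
  by have := hmin y'; rewrite -/P; lra.
have X0 : 0 < dot (x - z) (x - z) ^+ 2 + dot (x + z - 2 *: y) (x + z - 2 *: y).
  by rewrite -sqrtr_gt0.
have := sqrt_tangent X0 (penalty_arg_ge0 x y' z).
rewrite -/(penalty x y z) -/(penalty x y' z) -/P.
have C2 : 0 <= C / 2 by rewrite divr_ge0.
move=> /(ler_wpM2l C2); rewrite -lerN2; apply: le_trans.
have -> : x + z - 2 *: y' = (x + z - 2 *: y) - 2 *: e.
  by apply/matrixP => i j; rewrite !mxE; ring.
clearbody e; move: (x - z) (x + z - 2 *: y) => d s.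
rewrite !dotE (dotC e s) le_eqVlt; apply/orP; left; apply/eqP.
by field; exact: lt0r_neq0.
Qed.

End penalty.

Section semiconcavity.
Context {R : realType} {n : nat}.
Variables (A : 'cV[R]_n -> 'M[R]_n) (V : 'cV[R]_n -> R).
Hypotheses (A_sym_posdef : forall x, sym_posdef (A x)).
Hypotheses (A_smooth : smooth_mx A) (A_periodic : Zn_periodic A).
Hypotheses (V_smooth : smooth V) (V_periodic : Zn_periodic V).
Variables (a : R) (c : 'cV[R]_n) (u : 'cV[R]_n -> R).
Hypotheses (u_periodic : Zn_periodic u).
Hypotheses (u_viscosity : viscosity_solution (hamiltonian A V) c a u).
Let v y := u y + dot c y.
Local Notation H := (hamiltonian A V).
Implicit Types x y z : 'cV[R]_n.

(** Adding the linear function <c, y> translates semidifferentials by c, so v solves the equation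
    without the shift. *)
Lemma viscosity_superdiff x p : superdiff v x p -> H x p <= a.
Proof.
rewrite -{1 2}(subrKC c p) => h; apply: (u_viscosity.2 x).1.
by move: h; rewrite /superdiff /= diff_quotient_add_linear.
Qed.

Lemma viscosity_subdiff x p : subdiff v x p -> a <= H x p.
Proof.
rewrite -{1 2}(subrKC c p) => h; apply: (u_viscosity.2 x).2.
by move: h; rewrite /subdiff /= diff_quotient_add_linear.
Qed.

Lemma add_linear_continuous : continuous v.
Proof.
move=> x; have [cu _] := u_viscosity.
have cd : {for x, continuous (dot c)}.
  by apply: (@cvg_dot _ _ _ (fun=> c) id); [exact: cst_continuous|exact: cvg_id].
exact: cvgD (cu x) cd.
Qed.

Let Psi (C : R) x y z := v x + v z - 2 * v y - C * penalty x y z.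

(** The linear part of v enters only through <c, x + z - 2y>, which |c| times the penalty absorbs;
    the remaining unit of [C] then confines x and z to a bounded distance from y. Joint integer
    translations preserve [Psi], so y may be taken in the unit cube, and compactness applies. *)
Lemma penalized_max (C : R) x0 y0 z0 : enorm c + 1 <= C -> 0 < Psi C x0 y0 z0 ->
  exists x y z, 0 < Psi C x y z /\ forall x' y' z', Psi C x' y' z' <= Psi C x y z.
Proof.
move=> hC P0.
have [m m0 mP] := Zn_periodic_bounded u_viscosity.1 u_periodic.
pose B := 4 * m + 1.
have bnd x y z : 0 < Psi C x y z -> `|x - y| <= B /\ `|z - y| <= B.
  rewrite /Psi => hP.
  have e : v x + v z - 2 * v y = u x + u z - 2 * u y + dot c (x + z - 2 *: y).
    by rewrite /v !dotE; ring.
  rewrite e in hP.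
  have pen0 := penalty_ge0 x y z.
  have h1 := cauchy_schwarz c (x + z - 2 *: y).
  have h2 := ler_wpM2l (enorm_ge0 c) (enorm_le_penalty x y z).
  have h3 := ler_wpM2r pen0 hC.
  have := mP x; have := mP y; have := mP z.
  rewrite !ler_norml => /andP[_ hz] /andP[hy _] /andP[hx _]; have := mP x.
  rewrite ler_norml => /andP[_ {}hx].
  have pm : penalty x y z <= 4 * m by lra.
  have hs := le_trans (enorm_le_penalty x y z) pm.
  have hd := le_trans (enorm_sqr_le_penalty x y z) pm.
  have hd' : enorm (x - z) <= 4 * m + 1.
    have := sqr_ge0 (enorm (x - z) - 1); rewrite sqrrB; have := enorm_ge0 (x - z); lra.
  have hsn := norm_le_enorm (x + z - 2 *: y).
  have hdn := norm_le_enorm (x - z).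
  split.
    have -> : x - y = 2^-1 *: ((x + z - 2 *: y) + (x - z)).
      by apply/matrixP => i j; rewrite !mxE; field.
    rewrite normrZ ger0_norm//; have := ler_normD (x + z - 2 *: y) (x - z).
    rewrite /B; lra.
  have -> : z - y = 2^-1 *: ((x + z - 2 *: y) - (x - z)).
    by apply/matrixP => i j; rewrite !mxE; field.
  rewrite normrZ ger0_norm//; have := ler_normB (x + z - 2 *: y) (x - z).
  rewrite /B; lra.
have trans x y z k : Psi C (x + map_mx intr k) (y + map_mx intr k) (z + map_mx intr k) =
    Psi C x y z.
  rewrite /Psi /v !u_periodic !dotDr /penalty; set w := map_mx _ _.
  have -> : x + w - (z + w) = x - z by apply/matrixP => i j; rewrite !mxE; ring.
  have -> : x + w + (z + w) - 2 *: (y + w) = x + z - 2 *: y.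
    by apply/matrixP => i j; rewrite !mxE; ring.
  by ring.
pose Q := [set x : 'cV[R]_n | forall i, x i 0 \in `[0, 1]].
pose D := [set p : 'cV[R]_n | `|p| <= B].
have cK : compact (Q `*` (D `*` D)).
  apply: compact_setX; first exact: cV_compact_box.
  by apply: compact_setX; exact: cV_compact_ball.
have B0 : 0 <= B by rewrite /B; lra.
have ne : Q `*` (D `*` D) !=set0.
  exists (0, (0, 0)); split; last by split; rewrite /D /= normr0.
  by move=> i; rewrite !mxE in_itv /= lexx ler01.
(* Parametrizing by y and the offsets x - y, z - y makes the search domain a product of compact
   sets. *)
pose F (t : 'cV[R]_n * ('cV[R]_n * 'cV[R]_n)) := Psi C (t.1 + t.2.1) t.1 (t.1 + t.2.2).
have cF : continuous F.
  move=> t.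
  have c1 : {for t, continuous (fun t : 'cV[R]_n * ('cV[R]_n * 'cV[R]_n) => t.1)} by exact: cvg_fst.
  have c2 : {for t, continuous (fun t : 'cV[R]_n * ('cV[R]_n * 'cV[R]_n) => t.2)} by exact: cvg_snd.
  have c21 : {for t, continuous (fun t : 'cV[R]_n * ('cV[R]_n * 'cV[R]_n) => t.2.1)}.
    by apply: continuous_comp; [exact: c2|exact: cvg_fst].
  have c22 : {for t, continuous (fun t : 'cV[R]_n * ('cV[R]_n * 'cV[R]_n) => t.2.2)}.
    by apply: continuous_comp; [exact: c2|exact: cvg_snd].
  have cx : {for t, continuous (fun t : 'cV[R]_n * ('cV[R]_n * 'cV[R]_n) => t.1 + t.2.1)}.
    exact: cvgD c1 c21.
  have cz : {for t, continuous (fun t : 'cV[R]_n * ('cV[R]_n * 'cV[R]_n) => t.1 + t.2.2)}.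
    exact: cvgD c1 c22.
  have cv f : {for t, continuous f} ->
      {for t, continuous (fun t : 'cV[R]_n * ('cV[R]_n * 'cV[R]_n) => v (f t))}.
    by move=> cf; apply: continuous_comp; [exact: cf|exact: add_linear_continuous].
  apply: cvgB.
    apply: cvgB; first exact: cvgD (cv _ cx) (cv _ cz).
    apply: cvgM; [exact: cvg_cst|exact: (cv _ c1)].
  apply: cvgM; first exact: cvg_cst.
  apply: (@continuous_comp _ _ _ (fun t : 'cV[R]_n * ('cV[R]_n * 'cV[R]_n) =>
    dot (t.1 + t.2.1 - (t.1 + t.2.2)) (t.1 + t.2.1 - (t.1 + t.2.2)) ^+ 2 +
    dot (t.1 + t.2.1 + (t.1 + t.2.2) - 2 *: t.1) (t.1 + t.2.1 + (t.1 + t.2.2) - 2 *: t.1))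
    (@Num.sqrt R)); last exact: sqrt_continuous.
  have cd : {for t, continuous (fun t : 'cV[R]_n * ('cV[R]_n * 'cV[R]_n) =>
      t.1 + t.2.1 - (t.1 + t.2.2))} by exact: cvgB cx cz.
  have cs : {for t, continuous (fun t : 'cV[R]_n * ('cV[R]_n * 'cV[R]_n) =>
      t.1 + t.2.1 + (t.1 + t.2.2) - 2 *: t.1)}.
    apply: cvgB; first exact: cvgD cx cz.
    by apply: cvgZr; exact: c1.
  apply: cvgD; last exact: (cvg_dot cs cs).
  by apply: cvgM; exact: (cvg_dot cd cd).
have [[y1 [a1 b1]] _ hm] := compact_EVT_max ne cK (continuous_subspaceT cF).
have hpos x y z : 0 < Psi C x y z -> Psi C x y z <= Psi C (y1 + a1) y1 (y1 + b1).
  move=> hP; have [k kP] := translate_to_unit_cube y.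
  have [hx hz] := bnd _ _ _ hP.
  have := hm (y + map_mx intr k, (x - y, z - y)); rewrite /F /=.
  set w := map_mx _ _.
  have -> : y + w + (x - y) = x + w by apply/matrixP => i j; rewrite !mxE; ring.
  have -> : y + w + (z - y) = z + w by apply/matrixP => i j; rewrite !mxE; ring.
  by rewrite /w trans; apply; rewrite inE.
exists (y1 + a1), y1, (y1 + b1); split; first exact: lt_le_trans P0 (hpos _ _ _ P0).
move=> x y z; have [hP|hP] := leP (Psi C x y z) 0; last exact: hpos.
exact: le_trans hP (le_trans (ltW P0) (hpos _ _ _ P0)).
Qed.

(** At a positive maximum, coercivity bounds |q|, which keeps |x + z - 2y| below half the penalty;
    the penalty is then comparable to |x - z|^2, so |r| = 2C|x - z|^3 / P is at least C|x - z|. The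
    convexity estimate gives lam |r| <= L |x - z|, hence lam C <= L. *)
Lemma second_difference_le_penalty : exists2 C, 0 <= C &
  forall x y z, v x + v z - 2 * v y <= C * penalty x y z.
Proof.
have [M M0 MP] := hamiltonian_coercive A_sym_posdef A_smooth A_periodic V_smooth V_periodic a.
have [lam lam0 [K K0 HP]] :=
  hamiltonian_second_difference A_sym_posdef A_smooth A_periodic V_smooth V_periodic.
pose L := K * (2 * M ^+ 2 + 2 + M).
have L0 : 0 <= L.
  by apply: mulr_ge0 => //; rewrite !addr_ge0// mulr_ge0 ?sqr_ge0.
(* The summand |c| + 1 is for [penalized_max], 2M for 2|s| <= P, and L / lam + 1 contradicts lam C
   <= L. *)
pose C := enorm c + 1 + 2 * M + L / lam + 1.
have c0 := enorm_ge0 c.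
have Ll0 : 0 <= L / lam by rewrite divr_ge0// ltW.
have C0 : 0 <= C by rewrite /C; lra.
exists C => // x0 y0 z0; rewrite leNgt; apply/negP => hP0.
have [x [y [z [P0 hmax]]]] : exists x y z, 0 < Psi C x y z /\
    forall x' y' z', Psi C x' y' z' <= Psi C x y z.
  by apply: (@penalized_max C x0 y0 z0); [rewrite /C; lra|rewrite /Psi subr_gt0].
set P := penalty x y z.
(* A vanishing penalty forces x = y = z, where [Psi] is 0. *)
have Ppos : 0 < P.
  rewrite lt_neqAle penalty_ge0 andbT; apply/eqP => Pe.
  have := penalty_sqr x y z; rewrite -/P -Pe expr0n /=; move/eqP.
  rewrite eq_sym paddr_eq0 ?sqr_ge0 ?exprn_ge0 ?enorm_ge0// !expf_eq0 /= !enorm_eq0.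
  rewrite subr_eq0 => /andP[/eqP xz]; rewrite -xz => /eqP hy.
  have yx : y = x.
    apply/matrixP => i j; have /matrixP/(_ i j) := hy; rewrite !mxE; lra.
  by move: P0; rewrite /Psi -/P -Pe mulr0 subr0 -xz yx mulr_natl mulr2n subrr ltxx.
set s := x + z - 2 *: y; set d := x - z.
pose q := (C / P) *: s; pose r := (C / P) *: ((2 * enorm d ^+ 2) *: d).
have sup_x : superdiff v x (q + r).
  rewrite /q /r -scalerDr; apply: penalized_superdiff => // x'.
  by have := hmax x' y z; rewrite /Psi; lra.
have sup_z : superdiff v z (q - r).
  have -> : q - r = (C / penalty z y x) *: ((z + x - 2 *: y) + (2 * enorm (z - x) ^+ 2) *: (z - x)).
    by rewrite /q /r -scalerBr penaltyC -/P (addrC z) -(opprB x z) -/s -/d enormN scalerN.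
  apply: penalized_superdiff; rewrite // 1?penaltyC//.
  by move=> z'; have := hmax x y z'; rewrite /Psi !(penaltyC _ _ x); lra.
have sub_y : subdiff v y q.
  by apply: penalized_subdiff => // y'; have := hmax x y' z; rewrite /Psi; lra.
have Hx := viscosity_superdiff sup_x; have Hz := viscosity_superdiff sup_z.
have Hy := viscosity_subdiff sub_y.
have Mx := MP _ _ Hx; have Mz := MP _ _ Hz.
have qM : enorm q <= M.
  have -> : q = 2^-1 *: ((q + r) + (q - r)).
    by apply/matrixP => i j; rewrite !mxE; field; exact: lt0r_neq0.
  rewrite enormZ//; have := enormD (q + r) (q - r); lra.
have CP0 : 0 <= C / P by rewrite divr_ge0// ltW.
have Eq : enorm q * P = C * enorm s.
  by rewrite /q enormZ// mulrAC divfK// lt0r_neq0.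
have Er : enorm r * P = 2 * C * enorm d ^+ 3.
  rewrite /r enormZ// enormZ ?mulr_ge0 ?enorm_ge0//; field; exact: lt0r_neq0.
have := HP x y z q r; rewrite -/s -/d.
have := penalty_sqr x y z; rewrite -/P -/s -/d.
have := enorm_ge0 s; have := enorm_ge0 d; have := enorm_ge0 r; have := enorm_ge0 q.
move: (enorm q) (enorm r) (enorm d) (enorm s) qM Eq Er => Q Rr D S QM EQ ER Q0 R0 D0 S0 EP hH.
have {Hx Hz Hy}hH : lam * Rr ^+ 2 <= K * ((Q ^+ 2 + 1) * (S + D ^+ 2) + D * Q * Rr).
  by move: hH Hx Hz Hy; lra.
have S2P : 2 * S <= P.
  have C2M : 2 * M + 1 <= C by rewrite /C; lra.
  have Cpos : 0 < C by lra.
  rewrite -(ler_pM2l Cpos) mulrCA -EQ.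
  have h := ler_wpM2r (ltW Ppos) QM; have := ler_wpM2r (ltW Ppos) C2M; lra.
have S2 : 4 * S ^+ 2 <= P ^+ 2.
  have -> : 4 * S ^+ 2 = (2 * S) ^+ 2 by ring.
  by rewrite ler_sqr ?nnegrE ?mulr_ge0// ltW.
have SD : S <= D ^+ 2.
  rewrite -ler_sqr ?nnegrE ?sqr_ge0// -exprM.
  have := sqr_ge0 S; lra.
have PD : P <= 2 * D ^+ 2.
  rewrite -ler_sqr ?nnegrE ?(ltW Ppos)//; last by rewrite mulr_ge0 ?sqr_ge0.
  have -> : (2 * D ^+ 2) ^+ 2 = 4 * D ^+ 4 by ring.
  have := sqr_ge0 S; have := exprn_ge0 4 D0; lra.
have Dpos : 0 < D.
  rewrite lt_neqAle D0 andbT; apply/eqP => D00; move: PD.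
  by rewrite -D00 expr0n mulr0 leNgt Ppos.
have RC : C * D <= Rr.
  have h := ler_wpM2l R0 PD; rewrite ER in h.
  have D2 : 0 < 2 * D ^+ 2 by rewrite mulr_gt0// exprn_gt0.
  by rewrite -(ler_pM2r D2); apply: le_trans h; rewrite le_eqVlt; apply/orP; left; apply/eqP; ring.
have C1 : 1 <= C by rewrite /C; lra.
have DR : D <= Rr by apply: le_trans RC; rewrite -[leLHS]mul1r ler_wpM2r.
have Rpos : 0 < Rr by exact: lt_le_trans Dpos DR.
have h1 : (Q ^+ 2 + 1) * (S + D ^+ 2) <= (M ^+ 2 + 1) * (2 * (D * Rr)).
  apply: ler_pM.
  - by rewrite addr_ge0 ?sqr_ge0.
  - by rewrite addr_ge0 ?sqr_ge0.
  - by rewrite lerD2r ler_sqr ?nnegrE.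
  - have : D ^+ 2 <= D * Rr by rewrite expr2 ler_wpM2l.
    lra.
have h2 : D * Q * Rr <= D * M * Rr by rewrite ler_wpM2r// ler_wpM2l.
have h3 : lam * Rr ^+ 2 <= L * D * Rr.
  apply: le_trans hH _.
  have -> : L * D * Rr = K * ((M ^+ 2 + 1) * (2 * (D * Rr)) + D * M * Rr) by rewrite /L; ring.
  by apply: ler_wpM2l => //; exact: lerD.
have h4 : lam * Rr <= L * D by rewrite -(ler_pM2r Rpos) -mulrA -expr2.
have h5 : lam * C <= L.
  rewrite -(ler_pM2r Dpos); apply: le_trans h4.
  by rewrite -mulrA ler_pM2l.
move: h5; rewrite mulrC -ler_pdivlMr// /C; lra.
Qed.

End semiconcavity.

(** * Level sets near a point where 0 is not a superdifferential *)

Lemma near_normP {R : realType} {W : normedModType R} (P : set W) (x : W) :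
  (\forall y \near x, P y) <->
  exists2 d : R, 0 < d & forall y, `|y - x| < d -> P y.
Proof.
split=> [/nbhs_ballP[d /= d0 dP]|[d d0 dP]].
  by exists d => // y yd; apply: dP; rewrite -ball_normE /ball_ /= distrC.
by apply/nbhs_ballP; exists d => // y; rewrite -ball_normE /ball_ /= distrC; exact: dP.
Qed.

(** A negative minimum would be interior, and the strict midpoint inequality fails at an interior
    minimum. *)
Lemma midpoint_concave_ge0 {R : realType} (h : R -> R) : continuous h ->
  h 0 = 0 -> h 1 = 0 ->
  (forall t s : R, s != 0 -> h (t + s) + h (t - s) < 2 * h t) ->
  forall t, 0 <= t <= 1 -> 0 <= h t.
Proof.
move=> ch h0 h1 hm t t01.
have [m] := EVT_min (@ler01 R) (continuous_subspaceT ch).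
rewrite in_itv /= => /andP[m0 m1] mP.
suff hm0 : 0 <= h m by apply: le_trans hm0 (mP t _); rewrite in_itv.
rewrite leNgt; apply/negP => hmlt.
have m0' : 0 < m.
  by rewrite lt_neqAle m0 andbT; apply/eqP => e; rewrite -e h0 ltxx in hmlt.
have m1' : m < 1.
  by rewrite lt_neqAle m1 andbT; apply/eqP => e; rewrite e h1 ltxx in hmlt.
pose s := Num.min m (1 - m).
have s0 : 0 < s by rewrite lt_min m0' subr_gt0.
have sm : s <= m by rewrite ge_min lexx.
have s1 : s <= 1 - m by rewrite ge_min lexx orbT.
have := hm m s (lt0r_neq0 s0); rewrite ltNge => /negP; apply.
have := mP (m + s); have := mP (m - s); rewrite !in_itv /=.
have -> : 0 <= m - s <= 1 by apply/andP; split; lra.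
have -> : 0 <= m + s <= 1 by apply/andP; split; lra.
move=> /(_ isT) a /(_ isT); lra.
Qed.

Section semiconcave_functions.
Context {R : realType} {n : nat}.
Variables (v : 'cV[R]_n -> R) (L K : R).
Hypotheses (L0 : 0 <= L) (K0 : 0 <= K).
Hypothesis v_lipschitz : forall y z, `|v y - v z| <= L * `|y - z|.
Hypothesis v_semiconcave : forall y h, v (y + h) + v (y - h) - 2 * v y <= K * dot h h.
Implicit Types (x y z theta : 'cV[R]_n).

Lemma lipschitz_line_continuous z theta : continuous (fun t : R => v (z + t *: theta)).
Proof.
apply/norm_continuousP => t e e0; pose M := L * `|theta| + 1.
have M0 : 0 < M by rewrite ltr_wpDl// mulr_ge0.
exists (e / M) => [|s]; first by rewrite divr_gt0.
rewrite ltr_pdivlMr// => h; apply: le_lt_trans h.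
apply: le_trans (v_lipschitz _ _) _.
have -> : z + s *: theta - (z + t *: theta) = (s - t) *: theta.
  by apply/matrixP => i j; rewrite !mxE; ring.
rewrite normrZ mulrCA; apply: ler_wpM2l => //; rewrite /M; lra.
Qed.

(** Passes from midpoints to whole segments. Using K + 1 makes the corrected function strictly
    midpoint concave, as [midpoint_concave_ge0] requires. *)
Lemma semiconcave_segment z theta t : 0 <= t <= 1 ->
  (1 - t) * v z + t * v (z + theta) - (K + 1) * t * (1 - t) * dot theta theta <=
  v (z + t *: theta).
Proof.
move=> t01; have [->|th0] := eqVneq theta 0.
  by rewrite scaler0 addr0 dot0l; lra.
have D0 : 0 < dot theta theta by rewrite -enorm_sqr exprn_gt0// enorm_gt0.
pose h (s : R) := v (z + s *: theta) - (1 - s) * v z - s * v (z + theta)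
  + (K + 1) * s * (1 - s) * dot theta theta.
suff : 0 <= h t by rewrite /h; lra.
apply: midpoint_concave_ge0 t01.
- move=> s; have c1 : {for s, continuous (fun s : R => s)} by exact: cvg_id.
  have c2 : {for s, continuous (fun s : R => 1 - s)} by apply: cvgB => //; exact: cvg_cst.
  apply: cvgD; last first.
    apply: cvgM; last exact: cvg_cst.
    by apply: cvgM => //; apply: cvgM => //; exact: cvg_cst.
  apply: cvgB; last by apply: cvgM => //; exact: cvg_cst.
  apply: cvgB; last by apply: cvgM => //; exact: cvg_cst.
  exact: lipschitz_line_continuous.
- by rewrite /h scale0r addr0; ring.
- by rewrite /h scale1r; ring.
move=> s r r0; rewrite -subr_lt0.
have := v_semiconcave (z + s *: theta) (r *: theta).
have -> : z + s *: theta + r *: theta = z + (s + r) *: theta by rewrite scalerDl addrA.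
have -> : z + s *: theta - r *: theta = z + (s - r) *: theta by rewrite scalerBl addrA.
rewrite dotZl dotZr => sc.
have r20 : 0 < r * (r * dot theta theta).
  by rewrite mulrA mulr_gt0// -expr2 exprn_even_gt0.
have : 0 <= K * (r * (r * dot theta theta)) by rewrite mulr_ge0// ltW.
by rewrite /h; lra.
Qed.

Lemma increasing_direction x : ~ superdiff v x 0 ->
  exists theta del rho, [/\ 0 < del, 0 < rho & forall z t, `|z - x| < rho -> 0 <= t <= 1 ->
    v z + t * del <= v (z + t *: theta)].
Proof.
move=> nsup.
(* Otherwise a paraboloid with horizontal tangent would touch v from above at x. *)
have [theta hth] : exists theta, (K + 1) * dot theta theta < v (x + theta) - v x.
  apply: contrapT => hn; apply: nsup; apply: (@superdiff_quadratic _ _ _ _ _ (K + 1) 1) => // y _.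
  rewrite dot0l add0r leNgt; apply/negP => hy; apply: hn; exists (y - x).
  by rewrite [x + _]addrC subrK.
pose eta := v (x + theta) - v x - (K + 1) * dot theta theta.
have eta0 : 0 < eta by rewrite subr_gt0.
have L1 : 0 < 4 * (L + 1) by rewrite mulr_gt0// ltr_wpDl.
(* Replacing x by z changes the two values of v by at most 2L|z - x| <= eta / 2 in total, leaving
   half of the gain [eta]. *)
exists theta, (eta / 2), (eta / (4 * (L + 1))).
split; rewrite ?divr_gt0// => z t; rewrite ltr_pdivlMr// => zx t01.
apply: le_trans (semiconcave_segment z theta t01).
have := v_lipschitz (z + theta) (x + theta).
have -> : z + theta - (x + theta) = z - x by apply/matrixP => i j; rewrite !mxE; ring.
have := v_lipschitz z x; rewrite !ler_norml => /andP[_ h1] /andP[h2 _].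
have h3 : 0 <= v (z + theta) - v z - (K + 1) * dot theta theta - eta / 2.
  rewrite /eta in zx *; have := normr_ge0 (z - x); lra.
move: t01 => /andP[t0 t1].
have := mulr_ge0 t0 h3.
have : 0 <= (K + 1) * (t * t * dot theta theta).
  by rewrite mulr_ge0 ?addr_ge0// mulr_ge0 ?dot_ge0// mulr_ge0.
lra.
Qed.

End semiconcave_functions.

(** The lower envelope of the cones t y + k |p - w y|. The hypothesis also forces [t] to depend on
    [w] alone over [S], so the extension agrees with it there. *)
Lemma mcshane_extension {R : realType} {T : Type} {W : normedModType R}
    (S : set T) (w : T -> W) (t : T -> R) (k : R) : S !=set0 -> 0 <= k ->
  (forall y z, S y -> S z -> t y <= t z + k * `|w y - w z|) ->
  exists2 f : W -> R, (forall p q, `|f p - f q| <= k * `|p - q|) &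
    forall y, S y -> f (w y) = t y.
Proof.
move=> [y0 Sy0] k0 hS.
pose E p := [set t y + k * `|p - w y| | y in S].
have lbE p : lbound (E p) (t y0 - k * `|p - w y0|).
  move=> _ [y Sy <-]; have := hS _ _ Sy0 Sy.
  have := ler_wpM2l k0 (ler_distD p (w y0) (w y)); rewrite (distrC (w y0) p); lra.
have le p y : S y -> inf (E p) <= t y + k * `|p - w y|.
  by move=> Sy; apply: ge_inf; [exists (t y0 - k * `|p - w y0|)|exists y].
have lip p q : inf (E p) <= inf (E q) + k * `|p - q|.
  rewrite -lerBlDr; apply: lb_le_inf; first by exists (t y0 + k * `|q - w y0|), y0.
  move=> _ [y Sy <-]; have := le p y Sy; have := ler_wpM2l k0 (ler_distD q p (w y)); lra.
exists (fun p => inf (E p)) => [p q|y Sy].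
  by rewrite ler_norml; have := lip p q; have := lip q p;
    rewrite (distrC q) => a b; apply/andP; split; lra.
apply/eqP; rewrite eq_le; apply/andP; split.
  by apply: le_trans (le _ _ Sy) _; rewrite subrr normr0 mulr0 addr0.
apply: lb_le_inf; first by exists (t y0 + k * `|w y - w y0|), y0.
by move=> _ [z Sz <-]; exact: hS.
Qed.

Section linear_chart.
Context {R : realType} {n : nat}.
Variables (i : 'I_n) (theta : 'cV[R]_n).
Definition insert0 (w : 'cV[R]_n.-1) : 'cV[R]_n :=
  \col_j (if unlift i j is Some k then w k 0 else 0).

(** Projection along theta onto the hyperplane of zero [i]-th coordinate, with the height along
    theta; when that coordinate of theta is nonzero, it inverts (w, t) ->
    [insert0 w + t *: theta]. *)
Definition chart (y : 'cV[R]_n) : ('cV[R]_n.-1 * R^o)%type :=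
  (row' i (y - (y i 0 / theta i 0) *: theta), y i 0 / theta i 0).

Lemma chart_is_linear : linear chart.
Proof.
move=> k y z; congr pair; last by rewrite /= !mxE mulrDl -mulrA.
by apply/matrixP => a b; rewrite !mxE; ring.
Qed.

HB.instance Definition _ := GRing.isLinear.Build R 'cV[R]_n _ _ chart chart_is_linear.

Lemma insert0B w w' : insert0 (w - w') = insert0 w - insert0 w'.
Proof.
apply/matrixP => j k; rewrite !mxE.
by case: (unlift i j) => [a|]; rewrite ?mxE ?subrr.
Qed.

Lemma norm_insert0 w : `|insert0 w| <= `|w|.
Proof.
apply: norm_le => // j; rewrite mxE.
by case: (unlift i j) => [a|]; rewrite ?normr0// coord_le_norm.
Qed.

Hypothesis theta_i : theta i 0 != 0.

Lemma chartK y : insert0 (chart y).1 + (chart y).2 *: theta = y.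
Proof.
apply/matrixP => j k; rewrite ord1 !mxE; case: unliftP => [a ->|->].
  by rewrite !mxE subrK.
by rewrite add0r divfK.
Qed.

Lemma chart_insert0 (w : 'cV[R]_n.-1) (t : R) : chart (insert0 w + t *: theta) = (w, t).
Proof.
have e : (insert0 w + t *: theta) i 0 / theta i 0 = t.
  by rewrite !mxE unlift_none add0r mulfK.
rewrite /chart e addrK; congr pair.
by apply/matrixP => j k; rewrite !mxE liftK ord1.
Qed.

Lemma chart_bij : bijective chart.
Proof.
exists (fun p => insert0 p.1 + p.2 *: theta) => [y|[w t]]; first exact: chartK.
exact: chart_insert0.
Qed.

Lemma chart_theta : chart theta = (0, 1).
Proof.
rewrite -(chart_insert0 0 1) scale1r; congr chart.
by apply/matrixP => j k; rewrite !mxE; case: (unlift i j) => [a|]; rewrite ?mxE add0r.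
Qed.

Lemma chart_translate y t : chart (y + t *: theta) = ((chart y).1, (chart y).2 + t).
Proof.
by rewrite linearD linearZ /= chart_theta; congr pair; rewrite /= ?scaler0 ?addr0 ?[_ *: 1]mulr1.
Qed.

End linear_chart.

Lemma increasing_level_set {R : realType} {n : nat} (v : 'cV[R]_n -> R) (L : R)
    (x theta : 'cV[R]_n) (del rho : R) : 0 <= L ->
  (forall y z, `|v y - v z| <= L * `|y - z|) -> 0 < del -> 0 < rho ->
  (forall z t, `|z - x| < rho -> 0 <= t <= 1 -> v z + t * del <= v (z + t *: theta)) ->
  lipschitz_submanifold_near (level_set v x) x.
Proof.
move=> L0 vL del0 rho0 hinc.
have th0 : theta != 0.
  apply/eqP => th0; have := hinc x 1; rewrite th0 scaler0 addr0 subrr normr0.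
  move=> /(_ rho0); rewrite ler01 lexx => /(_ isT); lra.
have [i thi] : exists i, theta i 0 != 0.
  apply: contrapT => hn; move/eqP: th0; apply; apply/matrixP => i j.
  rewrite ord1 mxE; apply/eqP/negPn/negP => h; apply: hn; by exists i.
have nth0 : 0 < `|theta| by rewrite normr_gt0.
have nthi : 0 < `|theta i 0| by rewrite normr_gt0.
(* The second bound keeps height differences within the ball at most 1, the range where growth along
   theta is known. *)
pose rho0' := Num.min rho (`|theta i 0| / 2).
have r0 : 0 < rho0' by rewrite lt_min rho0 divr_gt0.
have r_rho : rho0' <= rho by rewrite ge_min lexx.
have r_th : rho0' <= `|theta i 0| / 2 by rewrite ge_min lexx orbT.
pose S := [set y | v y = v x /\ `|y - x| < rho0'].
have Sx : S x by split => //; rewrite subrr normr0.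
(* Lifting z to the height of y raises v by at least (t - t') del and lands within |w - w'| of y,
   where v has the same value as at z; so (t - t') del <= L |w - w'|. *)
have key y z : S y -> S z -> (chart i theta y).2 <=
    (chart i theta z).2 + L / del * `|(chart i theta y).1 - (chart i theta z).1|.
  move=> [vy yx] [vz zx].
  set w := (chart i theta y).1 ; set t := (chart i theta y).2.
  set w' := (chart i theta z).1 ; set t' := (chart i theta z).2.
  have [tt'|tt'] := leP t t'.
    by rewrite (le_trans tt')// lerDl mulr_ge0// divr_ge0// ltW.
  have tau1 : t - t' <= 1.
    have -> : t - t' = (y - z) i 0 / theta i 0 by rewrite /t /t' /chart /= !mxE -mulrBl.
    apply: le_trans (ler_norm _) _; rewrite normf_div ler_pdivrMr// mul1r.
    apply: le_trans (coord_le_norm _ _) _.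
    have := ler_distD x y z; rewrite (distrC x z); lra.
  have tau0 : 0 <= t - t' by rewrite subr_ge0 ltW.
  have := hinc z (t - t') (lt_le_trans zx r_rho); rewrite tau0 tau1 => /(_ isT) h.
  have e : z + (t - t') *: theta - y = insert0 i (w' - w).
    rewrite -{1}(chartK thi z) -{1}(chartK thi y) -/w -/w' -/t -/t' insert0B.
    by apply/matrixP => a b; rewrite !mxE; ring.
  clearbody w t w' t'.
  have := vL (z + (t - t') *: theta) y; rewrite e ler_norml => /andP[_ h2].
  have h3 := ler_wpM2l L0 (norm_insert0 i (w' - w)).
  have h4 : (t - t') * del <= L * `|w' - w| by lra.
  rewrite -lerBlDl [leRHS]mulrAC ler_pdivlMr// [`|w - _|]distrC; exact: h4.
have [f fL fS] := mcshane_extension (ex_intro _ x Sx) (divr_ge0 L0 (ltW del0)) key.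
exists (chart i theta : {linear _ -> _}), f; split.
- exact: (chart_bij thi).
- apply: (@klipschitzW _ _ _ (L / del)).
    exact: (@globally_properfilter _ _ ((0, 0) : 'cV[R]_n.-1 * 'cV[R]_n.-1)).
  by move=> [p q] _ /=; exact: fL.
(* For y close to x, moving by [tau] along plus or minus theta stays in the ball, and the change
   [tau * del] outweighs L|y - x|, so v(x) lies between the two end values. *)
pose tau := Num.min 1 (rho0' / (4 * `|theta|)).
have tau0 : 0 < tau by rewrite lt_min ltr01 divr_gt0// mulr_gt0.
have tau1 : tau <= 1 by rewrite ge_min lexx.
have tauth : tau * `|theta| <= rho0' / 4.
  have : tau <= rho0' / (4 * `|theta|) by rewrite ge_min lexx orbT.
  rewrite ler_pdivlMr ?mulr_gt0//; lra.
have L1 : 0 < L + 1 by lra.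
apply/near_normP; exists (Num.min (rho0' / 4) (tau * del / (L + 1))).
  by rewrite lt_min !divr_gt0// mulr_gt0.
move=> y; rewrite lt_min ltr_pdivlMr// ltr_pdivlMr// => /andP[yx1 yx2].
have yx0 := normr_ge0 (y - x).
have Lyx : L * `|y - x| <= tau * del by lra.
have dist s : `|s| <= tau -> `|y + s *: theta - x| < rho0'.
  move=> sa; have -> : y + s *: theta - x = (y - x) + s *: theta.
    by apply/matrixP => a b; rewrite !mxE; ring.
  apply: le_lt_trans (ler_normD _ _) _; rewrite normrZ.
  have := ler_wpM2r (ltW nth0) sa; lra.
have nty : `|- tau| <= tau by rewrite normrN gtr0_norm.
split=> [yS|yf].
  rewrite fS//; split => //; have := dist 0; rewrite scale0r addr0 normr0; apply; exact: ltW.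
have t01 : 0 <= tau <= 1 by rewrite tau1 ltW.
have up : v x <= v (y + tau *: theta).
  have yr : `|y - x| < rho by lra.
  have := hinc y tau yr t01; have := vL y x; rewrite ler_norml => /andP[h _] ; lra.
have dn : v (y + (- tau) *: theta) <= v x.
  have := hinc _ tau (lt_le_trans (dist _ nty) r_rho) t01.
  have -> : y + (- tau) *: theta + tau *: theta = y by rewrite scaleNr subrK.
  have := vL y x; rewrite ler_norml => /andP[_ h]; lra.
have [s] : exists2 s, s \in `[(- tau), tau] & v (y + s *: theta) = v x.
  apply: (@IVT _ (fun s : R => v (y + s *: theta)) (- tau) tau (v x)); first lra.
    by apply: continuous_subspaceT; exact: lipschitz_line_continuous L0 vL _ _.
  have dnup := le_trans dn up.
  by rewrite (min_l dnup) (max_r dnup) dn up.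
rewrite in_itv /= => sI vs.
have sS : S (y + s *: theta) by split => //; apply: dist; rewrite ler_norml.
(* The level point found on the line through y has the height prescribed by [f], which y has too; so
   they coincide. *)
have := fS _ sS; rewrite chart_translate//= -yf => /eqP.
rewrite -subr_eq0 opprD addrA subrr add0r oppr_eq0 => /eqP s0.
by move: vs; rewrite s0 scale0r addr0.
Qed.

(** * Graphs, cones and small subdifferentials *)

Lemma linear_norm_le {R : realType} {n : nat} {W : normedModType R}
    (f : {linear 'cV[R]_n -> W}) :
  exists2 K, 0 <= K & forall e, `|f e| <= K * `|e|.
Proof.
exists (\sum_i `|f (delta_mx i 0)|) => [|e]; first exact: sumr_ge0.
have -> : e = \sum_i e i 0 *: delta_mx i 0.
  by rewrite {1}(matrix_sum_delta e); apply: eq_bigr => i _; rewrite big_ord1.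
rewrite linear_sum; apply: le_trans (ler_norm_sum _ _ _) _.
rewrite mulr_suml; apply: ler_sum => i _; rewrite linearZ normrZ mulrC ler_wpM2l//.
have -> : \sum_i e i 0 *: delta_mx i 0 = e.
  by rewrite {2}(matrix_sum_delta e); apply: eq_bigr => j _; rewrite big_ord1.
exact: coord_le_norm.
Qed.

Lemma segment_gt {R : realType} {n : nat} (v : 'cV[R]_n -> R) (k : R) (y z : 'cV[R]_n) :
  continuous v -> (forall s, 0 <= s <= 1 -> v (y + s *: (z - y)) <> k) ->
  k < v y -> k < v z.
Proof.
move=> cv hk ky; rewrite ltNge; apply/negP => zk.
have cg : continuous (fun s : R => v (y + s *: (z - y))).
  move=> s; apply: continuous_comp; last exact: cv.
  apply: cvgD; first exact: cvg_cst.
  exact: scalel_continuous.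
have [|s] := @IVT R _ 0 1 k ler01 (continuous_subspaceT cg).
  have -> : y + 0 *: (z - y) = y by rewrite scale0r addr0.
  have -> : y + 1 *: (z - y) = z by rewrite scale1r [y + _]addrC subrK.
  have zy : v z <= v y by exact: le_trans zk (ltW ky).
  by rewrite (min_r zy) (max_l zy) zk ltW.
by rewrite in_itv /=; exact: hk.
Qed.

(** Near x the level set is the zero set of the signed height [Phi]. A nearby point with v > v(x)
    selects a side; that side is connected near x and avoids the level set, so v > v(x) on all of
    it. It contains a cone because [Phi] is Lipschitz and grows at unit rate along theta. *)
Lemma lipschitz_graph_cone {R : realType} {n : nat} (v : 'cV[R]_n -> R) (x : 'cV[R]_n) :
  continuous v -> ~ local_maximum v x -> lipschitz_submanifold_near (level_set v x) x ->
  exists theta kap rho, [/\ 0 < kap, 0 < rho & forall t h, 0 < t -> t < rho ->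
    `|h| <= kap * t -> v x < v (x + t *: theta + h)].
Proof.
move=> cv nmax [L [f [[g Lg gL] lipf /near_normP[d d0 hd]]]].
have [K K0 KP] := linear_norm_le L.
have [M [M0 MP]] : exists M, 0 < M /\ forall p q, `|f p - f q| <= M * `|p - q|.
  have /pinfty_ex_gt0[M M0 MP] := lipf; exists M; split => // p q.
  exact: (MP (p, q) (conj I I)).
pose theta := g (0, 1).
have Lth : L theta = (0, 1) by rewrite gL.
pose Phi y := (L y).2 - f (L y).1.
have Phi_tr y t : Phi (y + t *: theta) = Phi y + t.
  rewrite /Phi linearD linearZ /= Lth /= scaler0 addr0.
  by rewrite [_ *: 1]mulr1; ring.
pose K' := K * (1 + M).
have K'0 : 0 <= K' by rewrite mulr_ge0// addr_ge0// ltW.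
have Phi_lip y z : `|Phi y - Phi z| <= K' * `|y - z|.
  have -> : Phi y - Phi z = (L (y - z)).2 - (f (L y).1 - f (L z).1).
    by rewrite /Phi linearB /=; ring.
  apply: le_trans (ler_normB _ _) _.
  have h0 := KP (y - z).
  have h1 : `|(L (y - z)).2| <= `|L (y - z)| by rewrite prod_normE le_max lexx orbT.
  have h2 : `|(L (y - z)).1| <= `|L (y - z)| by rewrite prod_normE le_max lexx.
  have h3 := MP (L y).1 (L z).1.
  have e : (L y).1 - (L z).1 = (L (y - z)).1 by rewrite linearB.
  rewrite e in h3.
  have h4 := ler_wpM2l (ltW M0) (le_trans h2 h0).
  rewrite /K'; lra.
have Phi_x : Phi x = 0.
  by have [h _] := hd x (ltac:(by rewrite subrr normr0)); rewrite /Phi h ?subrr.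
have Phi_bd y : `|Phi y| <= K' * `|y - x| by have := Phi_lip y x; rewrite Phi_x subr0.
have Phi_neq y : `|y - x| < d -> Phi y != 0 -> v y <> v x.
  by move=> yd /eqP Py vy; apply: Py; have [h _] := hd y yd; rewrite /Phi h ?subrr.
have th0 := normr_ge0 theta.
(* Chosen so that a point of the r-ball lifted by at most T = (K' + 1) r along theta stays within r
   Q = d of x. *)
pose Q := 1 + (K' + 1) * `|theta|.
have Q0 : 0 < Q by rewrite ltr_pwDl// mulr_ge0// addr_ge0.
pose r := d / Q.
have r0 : 0 < r by rewrite divr_gt0.
have rQ : r * Q = d by rewrite divfK// lt0r_neq0.
have [y1 [y1r vy1]] : exists y1, `|y1 - x| < r /\ v x < v y1.
  apply: contrapT => hn; apply: nmax; apply/near_normP; exists r => // y yr.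
  by rewrite leNgt; apply/negP => h; apply: hn; exists y.
have rd y : `|y - x| < r -> `|y - x| < d.
  move=> h; apply: lt_le_trans h _; rewrite -rQ /Q mulrDr mulr1 lerDl.
  by apply: mulr_ge0; [exact: ltW|apply: mulr_ge0 => //; exact: addr_ge0].
have Phi1 : Phi y1 != 0.
  apply/eqP => h; have [_ h2] := hd y1 (rd _ y1r).
  suff e : v y1 = v x by rewrite e ltxx in vy1.
  by apply: h2; apply/eqP; rewrite -subr_eq0 -/(Phi y1) h.
pose sg := Num.sg (Phi y1).
have sg1 : `|sg| = 1 by rewrite normr_sg Phi1.
have sg2 : sg * sg = 1 by rewrite -expr2 -real_normK ?num_real// sg1 expr1n.
have sgy1 : 0 < sg * Phi y1 by rewrite -normrEsg normr_gt0.
pose T := (K' + 1) * r.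
have T0 : 0 < T by rewrite mulr_gt0// ltr_wpDl.
have sgPhi y s : sg * Phi (y + (sg * s) *: theta) = sg * Phi y + s.
  by rewrite Phi_tr mulrDr mulrA sg2 mul1r.
have near_d y s : `|y - x| < r -> `|s| <= T -> `|y + (sg * s) *: theta - x| < d.
  move=> yr sT; rewrite addrAC; apply: le_lt_trans (ler_normD _ _) _.
  rewrite normrZ normrM sg1 mul1r.
  have := ler_wpM2r th0 sT; rewrite -rQ /T /Q; lra.
have pos_neq y : `|y - x| < d -> 0 < sg * Phi y -> v y <> v x.
  move=> yd hp; apply: Phi_neq => //; apply/eqP => h.
  by rewrite h mulr0 ltxx in hp.
(* The path lifts y1 by [T], crosses at that height and descends to y2. In the ball |Phi| <= K' r <
   T, so the crossing remains on the chosen side. *)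
have conn y2 : `|y2 - x| < r -> 0 < sg * Phi y2 -> v x < v y2.
  move=> y2r hy2.
  have up y s : `|y - x| < r -> 0 < sg * Phi y -> 0 <= s <= 1 ->
      v (y + (sg * (s * T)) *: theta) <> v x.
    move=> yr hy /andP[s0 s1]; have sT0 : 0 <= s * T by rewrite mulr_ge0// ltW.
    apply: pos_neq; last by rewrite sgPhi ltr_wpDr.
    by apply: near_d => //; rewrite ger0_norm// ler_piMl// ltW.
  have s1 : v x < v (y1 + (sg * T) *: theta).
    apply: segment_gt cv _ vy1 => s s01.
    have -> : y1 + s *: (y1 + (sg * T) *: theta - y1) = y1 + (sg * (s * T)) *: theta.
      by apply/matrixP => i j; rewrite !mxE; ring.
    exact: up.
  have s2 : v x < v (y2 + (sg * T) *: theta).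
    apply: segment_gt cv _ s1 => s /andP[s0 s1'].
    have -> : y1 + (sg * T) *: theta + s *: (y2 + (sg * T) *: theta - (y1 + (sg * T) *: theta))
       = y1 + s *: (y2 - y1) + (sg * T) *: theta.
      by apply/matrixP => i j; rewrite !mxE; ring.
    have yr : `|y1 + s *: (y2 - y1) - x| < r.
      have -> : y1 + s *: (y2 - y1) - x = (1 - s) *: (y1 - x) + s *: (y2 - x).
        by apply/matrixP => i j; rewrite !mxE; ring.
      apply: le_lt_trans (ler_normD _ _) _; rewrite !normrZ (ger0_norm s0) ger0_norm ?subr_ge0//.
      have [->|sn0] := eqVneq s 0; first by rewrite subr0 mul0r mul1r addr0.
      have s0' : 0 < s by rewrite lt_neqAle eq_sym sn0.
      have h1 : s * `|y2 - x| < s * r by rewrite ltr_pM2l.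
      have h2 : (1 - s) * `|y1 - x| <= (1 - s) * r.
        by apply: ler_wpM2l; [rewrite subr_ge0|exact: ltW].
      lra.
    apply: pos_neq; first by apply: near_d => //; rewrite ger0_norm// ltW.
    rewrite sgPhi.
    have hb : `|sg * Phi (y1 + s *: (y2 - y1))| <= K' * r.
      rewrite normrM sg1 mul1r; apply: le_trans (Phi_bd _) _.
      by apply: ler_wpM2l => //; exact: ltW.
    by move: hb; rewrite ler_norml /T => /andP[hb _]; lra.
  apply: segment_gt cv _ s2 => s /andP[s0 s1'].
  have -> : y2 + (sg * T) *: theta + s *: (y2 - (y2 + (sg * T) *: theta)) =
      y2 + (sg * ((1 - s) * T)) *: theta.
    by apply/matrixP => i j; rewrite !mxE; ring.
  by apply: up => //; rewrite subr_ge0 s1' lerBlDr lerDl.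
(* With this aperture the displacement h changes the height by at most K' kap t < t. *)
pose kap := (K' + 1)^-1.
have kap0 : 0 < kap by rewrite invr_gt0 ltr_wpDl.
have thk : 0 < `|theta| + kap by rewrite ltr_wpDl.
exists (sg *: theta), kap, (r / (`|theta| + kap)); split => //; first by rewrite divr_gt0.
move=> t h t0; rewrite ltr_pdivlMr// => tr hk.
have e : x + t *: (sg *: theta) + h = (x + h) + (sg * t) *: theta.
  by apply/matrixP => i j; rewrite !mxE; ring.
apply: conn.
  have -> : x + t *: (sg *: theta) + h - x = t *: (sg *: theta) + h.
    by apply/matrixP => i j; rewrite !mxE; ring.
  apply: le_lt_trans (ler_normD _ _) _; rewrite !normrZ sg1 mul1r gtr0_norm//.
  lra.
rewrite e sgPhi.
have hb : `|sg * Phi (x + h)| <= K' * (kap * t).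
  rewrite normrM sg1 mul1r; apply: le_trans (Phi_bd _) _.
  by apply: ler_wpM2l => //; rewrite [x + h]addrC addrK.
have K'k : K' * kap < 1 by rewrite ltr_pdivrMr ?ltr_wpDl// mul1r ltrDl.
have : K' * kap * t < 1 * t by rewrite ltr_pM2r.
by move: hb; rewrite ler_norml => /andP[hb _]; lra.
Qed.

Lemma paraboloid_continuous {R : realType} {n : nat} (v : 'cV[R]_n -> R)
    (y : 'cV[R]_n) (mu : R) :
  continuous v -> continuous (fun h : 'cV[R]_n => v (y + h) + mu * dot h h).
Proof.
move=> cv h.
have c1 : {for h, continuous (fun h : 'cV[R]_n => v (y + h))}.
  apply: continuous_comp; last exact: cv.
  have cy : {for h, continuous (fun _ : 'cV[R]_n => y)} by exact: cst_continuous.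
  have ci : {for h, continuous (fun h : 'cV[R]_n => h)} by exact: cvg_id.
  exact: cvgD cy ci.
have c2 : {for h, continuous (fun h : 'cV[R]_n => dot h h)}.
  by apply: (@cvg_dot _ _ _ id id); exact: cvg_id.
have c3 : {for h, continuous (fun h : 'cV[R]_n => mu * dot h h)}.
  have c0 : {for h, continuous (fun _ : 'cV[R]_n => mu)} by exact: cst_continuous.
  exact: cvgM c0 c2.
exact: cvgD c1 c3.
Qed.

(* A concave paraboloid with vertex on the axis of the cone touches the graph *)
(* of v from below inside the cone, where v is flat to first order at x.      *)
Lemma cone_small_subgradient {R : realType} {n : nat} (v : 'cV[R]_n -> R)
    (x theta : 'cV[R]_n) (kap rho eps : R) :
  continuous v -> superdiff v x 0 -> 0 < kap -> 0 < rho ->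
  (forall t h, 0 < t -> t < rho -> `|h| <= kap * t -> v x < v (x + t *: theta + h)) ->
  0 < eps -> exists y p, subdiff v y p /\ enorm p <= eps.
Proof.
move=> cv sup0 kap0 rho0 hcone eps0.
have th0 := normr_ge0 theta.
have N0 : 0 < 2 * n.+1%:R * (`|theta| + 1) by rewrite mulr_gt0 ?mulr_gt0// ltr_wpDl.
(* Makes the final slope 2 mu |h| at most eps |theta| / (|theta| + 1). *)
pose eta := eps * kap / (2 * n.+1%:R * (`|theta| + 1)).
have eta0 : 0 < eta by rewrite divr_gt0// mulr_gt0.
have [d d0 dP] := superdiff_le sup0 eta0.
pose t := Num.min (rho / 2) (d / 2 / (`|theta| + 1)).
have th1 : 0 < `|theta| + 1 by rewrite ltr_wpDl.
have t0 : 0 < t by rewrite lt_min !divr_gt0.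
have t_rho : t < rho.
  have : t <= rho / 2 by rewrite ge_min lexx.
  lra.
have t_d : t * `|theta| < d.
  have : t <= d / 2 / (`|theta| + 1) by rewrite ge_min lexx orbT.
  rewrite ler_pdivlMr//; lra.
pose y0 := x + t *: theta.
have vy0 : v y0 - v x <= eta * (t * `|theta|).
  have e : y0 - x = t *: theta by rewrite /y0 addrAC subrr add0r.
  have := dP y0; rewrite e normrZ gtr0_norm// dot0l subr0; exact.
(* On the sphere |h| = kap t the added quadratic term is at least eta t |theta|, which bounds v(y0)
   - v(x). As v > v(x) there, values on the sphere exceed the value at the centre, so the minimum is
   interior. *)
pose mu := eta * `|theta| / (kap ^+ 2 * t).
have k2t : 0 < kap ^+ 2 * t by rewrite mulr_gt0// exprn_gt0.
have mu0 : 0 <= mu by rewrite divr_ge0 ?mulr_ge0// ltW.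
have muE : mu * (kap * t) ^+ 2 = eta * (t * `|theta|).
  by rewrite /mu; field; rewrite !lt0r_neq0.
have kt0 : 0 < kap * t by rewrite mulr_gt0.
have ne : [set h : 'cV[R]_n | `|h| <= kap * t] !=set0.
  by exists 0; rewrite /= normr0 ltW.
have cg := @paraboloid_continuous _ _ _ y0 mu cv.
have [h] := compact_EVT_min ne (@cV_compact_ball R n (kap * t)) (continuous_subspaceT cg).
rewrite inE /= => hkt hmin.
have h_in : `|h| < kap * t.
  rewrite lt_neqAle hkt andbT; apply/eqP => he.
  have := hmin 0; rewrite inE /= normr0 (ltW kt0) => /(_ isT).
  rewrite addr0 dot0l mulr0 addr0.
  have := hcone t h t0 t_rho hkt; rewrite -/y0.
  have : mu * (kap * t) ^+ 2 <= mu * dot h h.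
    apply: ler_wpM2l => //; rewrite -enorm_sqr -he ler_sqr ?nnegrE ?enorm_ge0//.
    exact: norm_le_enorm.
  rewrite muE; lra.
exists (y0 + h), (- (2 * mu) *: h); split.
  apply: (@subdiff_quadratic _ _ _ _ _ mu (kap * t - `|h|)); first by rewrite subr_gt0.
  move=> y hy; set e := y - (y0 + h) in hy *.
  have ye : y = y0 + (h + e) by rewrite addrA /e [y0 + h + _]addrC subrK.
  have := hmin (h + e); rewrite inE /= -ye.
  have -> : `|h + e| <= kap * t.
    apply: le_trans (ler_normD _ _) _; lra.
  move=> /(_ isT); clearbody e; rewrite !dotE (dotC e h); lra.
rewrite -enormN -scaleNr opprK enormZ; last by rewrite mulr_ge0.
have hn : enorm h <= n.+1%:R * (kap * t).
  apply: le_trans (enorm_le_norm h) _.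
  by apply: ler_pM => //; rewrite ler_nat.
have mu2 : 0 <= 2 * mu by rewrite mulr_ge0.
apply: le_trans (ler_wpM2l mu2 hn) _.
have -> : 2 * mu * (n.+1%:R * (kap * t)) = eps * (`|theta| / (`|theta| + 1)).
  by rewrite /mu /eta; field; rewrite !lt0r_neq0.
by rewrite ger_pMr// ler_pdivrMr// mul1r lerDl.
Qed.

Theorem theorem3p2 (R : realType) (n : nat) (n_ge2 : (2 <= n)%N)
    (A : 'cV[R]_n -> 'M[R]_n) (V : 'cV[R]_n -> R)
    (A_sym_posdef : forall x, sym_posdef (A x))
    (A_smooth : smooth_mx A) (A_periodic : Zn_periodic A)
    (V_smooth : smooth V) (V_periodic : Zn_periodic V)
    (c : 'cV[R]_n)
    (c_supercritical : torus_max V < mather_alpha (hamiltonian A V) c)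
    (u : 'cV[R]_n -> R) (u_periodic : Zn_periodic u)
    (u_viscosity : viscosity_solution (hamiltonian A V) c
                     (mather_alpha (hamiltonian A V) c) u)
    (v : 'cV[R]_n -> R) (v_def : forall y, v y = u y + dot c y)
    (x : 'cV[R]_n) (x_singular : singular_set v x) :
  ~ superdiff v x 0 <->
  ~ local_maximum v x /\ lipschitz_submanifold_near (level_set v x) x.
Proof.
have {v_def x_singular} -> : v = fun y => u y + dot c y by exact/funext.
set w := fun y => _.
split=> [nsup|[nmax hsub] sup0].
  split.
    move=> /near_normP[d d0 hd]; apply: nsup.
    apply: (@superdiff_quadratic _ _ _ _ _ 0 d) => // y /hd.
    by rewrite dot0l add0r mul0r subr_le0.
  have [C C0 CP] := second_difference_le_penalty A_sym_posdef A_smooth A_periodic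
    V_smooth V_periodic u_periodic u_viscosity.
  have L0 : 0 <= C * n%:R by rewrite mulr_ge0.
  have lip1 y z : w y - w z <= C * n%:R * `|y - z|.
    have := CP y z y; rewrite penalty_diag.
    have := ler_wpM2l C0 (enorm_le_norm (y - z)); rewrite /w; lra.
  have lip y z : `|w y - w z| <= C * n%:R * `|y - z|.
    by rewrite ler_norml lip1 andbT lerNl opprB distrC lip1.
  have sc y h : w (y + h) + w (y - h) - 2 * w y <= C * 4 * dot h h.
    by have := CP (y + h) y (y - h); rewrite penalty_midpoint mulrA.
  have C40 : 0 <= C * 4 by rewrite mulr_ge0.
  have [theta [del [rho [del0 rho0 hinc]]]] := increasing_direction L0 C40 lip sc nsup.
  exact: increasing_level_set L0 lip del0 rho0 hinc.
have cw : continuous w by exact: add_linear_continuous u_viscosity.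
have [theta [kap [rho [kap0 rho0 hcone]]]] := lipschitz_graph_cone cw nmax hsub.
have [L L0 LP] := hamiltonian_upper V A_smooth A_periodic.
have [m _ mP] := Zn_periodic_bounded (V_smooth 0) V_periodic.
have VM y : V y <= torus_max V.
  apply: ub_le_sup; last by exists y.
  by exists m => _ [z _ <-]; apply: le_trans (mP z); exact: ler_norm.
pose gap := mather_alpha (hamiltonian A V) c - torus_max V.
have gap0 : 0 < gap by rewrite subr_gt0.
(* With eps <= 1, |p| <= eps gives L |p|^2 <= L eps < gap, so H(y, p) stays strictly below
   alpha(c). *)
pose eps := Num.min 1 (gap / (L + 1)).
have L1 : 0 < L + 1 by rewrite ltr_wpDl.
have eps0 : 0 < eps by rewrite lt_min ltr01 divr_gt0.
have eps1 : eps <= 1 by rewrite ge_min lexx.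
have epsL : eps * (L + 1) <= gap by rewrite -ler_pdivlMr// ge_min lexx orbT.
have [y [p [/(viscosity_subdiff u_viscosity) hp pe]]] :=
  cone_small_subgradient cw sup0 kap0 rho0 hcone eps0.
have := le_trans hp (LP y p); have := VM y.
have : L * enorm p ^+ 2 <= L * eps.
  apply: ler_wpM2l => //; apply: (@le_trans _ _ (eps ^+ 2)).
    by rewrite ler_sqr ?nnegrE ?enorm_ge0// ltW.
  by rewrite expr2 ler_piMl// ltW.
move: epsL; rewrite /gap; lra.
Qed.
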